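(* Let $T$ be a countable complete first-order theory in the setting described in the context. Let $N\models T^P$ and assume that $T$ is fully stable over $N$. (i) Then $T$ has the full existence property over $N$: every complete set $A$ with $P^A=N$ has the existence property. More specifically, for every complete set $A$ with $P^A=N$ there is $M\models T$ with $A\subseteq M$, $P^M=P^A$ and $|M|\le |A|+\aleph_0$. (ii) Moreover, the model $M$ in (i) can be chosen locally constructible (hence $\aleph_1$-constructible) over $A$.
   Context: Setting: $T$ is a complete first-order theory whose language contains a distinguished unary predicate $P$ and no function symbols (every subset is treated as a substructure), and $T$ implies $P$ is infinite. $\mathcal C$ is a monster model of $T$; all models are elementary submodels of $\mathcal C$ and all sets are subsets of $\mathcal C$. For a set $A$, $P^A=A\cap P^{\mathcal C}$; $\mathcal C^P$ is the substructure with universe $P^{\mathcal C}$ and $T^P=\mathrm{Th}(\mathcal C^P)$. Standing hypotheses: (1) every subset of $P^{\mathcal C}$ definable in $\mathcal C$ with parameters is definable with parameters from $P^{\mathcal C}$; (2) every subset of $P^{\mathcal C}$ that is $0$-definable in $\mathcal C$ is $0$-definable in $\mathcal C^P$; (3) $T$ has quantifier elimination. A set $A$ is complete if for every formula $\psi(\bar x,\bar y)$ and $\bar b\subseteq A$, if $\models(\exists \bar x\in P)\psi(\bar x,\bar b)$ then there is $\bar a\subseteq P\cap A$ with $\models\psi(\bar a,\bar b)$. For complete $A$, $S_*(A)$ is the set of types $\mathrm{tp}(\bar c/A)$ ($\bar c$ a finite tuple) such that $P\cap(A\cup\bar c)=P\cap A$ and $A\cup\bar c$ is complete. Write $A\equiv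 A'$ if $\mathrm{Th}(\mathcal C|_A)=\mathrm{Th}(\mathcal C|_{A'})$. A complete set $A$ is stable (over $P$) if $|S_*(A')|\le|A'|^{|T|}$ for all $A'\equiv A$. $T$ is fully stable over $N\models T^P$ if every complete set $A$ with $P^A=N$ is stable. A set $A$ has the existence property if there is $M\models T$ with $A\subseteq M$ and $P^M=P^A$. A type $p$ over a set $C$ is locally isolated if for every formula $\varphi(\bar x,\bar y)$ there is a formula $\theta_\varphi(\bar x,\bar a)\in p$ which implies $p\restriction\varphi$ (the set of formulas of the form $\pm\varphi(\bar x,\bar c)$, $\bar c\in C$, in $p$). $p$ is $\aleph_1$-isolated if some countable $r\subseteq p$ implies $p$. A model $M\supseteq A$ is locally constructible (resp. $\aleph_1$-constructible) over $A$ if $M=A\cup\{d_i:i<\alpha\}$ for some sequence with $\mathrm{tp}(d_i/A\cup\{d_j:j<i\})$ locally isolated (resp. $\aleph_1$-isolated) for every $i<\alpha$. *)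

(* Defs.v *)
From mathcomp Require Import all_boot all_order.
From mathcomp Require Import all_classical wochoice.

Set Implicit Arguments.
Unset Strict Implicit.
Unset Printing Implicit Defensive.

Local Open Scope classical_set_scope.
Local Open Scope card_scope.

(* Relational first-order languages.  The distinguished unary predicate P is
   not listed among the symbols: it is the built-in atom [InP] below.  *)
Record language := Language { symbol : Type; arity : symbol -> nat }.

(* [formula L n]: formulas whose free variables are among x_0, ..., x_(n-1).
   [All] binds variable 0 and shifts the others by one.  *)
Inductive formula (L : language) : nat -> Type :=
| Eq n : 'I_n -> 'I_n -> formula L n
| InP n : 'I_n -> formula L n
| Rel n (R : symbol L) : (arity R).-tuple 'I_n -> formula L n
| Bot n : formula L n
| Imp n : formula L n -> formula L n -> formula L n
| All n : formula L n.+1 -> formula L n.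

Definition Neg L n (phi : formula L n) : formula L n := Imp phi (Bot L n).

Definition sentence L := formula L 0.

Fixpoint quantifier_free L n (phi : formula L n) : Prop :=
  match phi with
  | Imp _ f g => quantifier_free f /\ quantifier_free g
  | All _ _ => False
  | _ => True
  end.

Record structure (L : language) := Structure {
  carrier :> Type;
  predP : set carrier;
  interp : forall R : symbol L, set ('I_(arity R) -> carrier) }.

Definition vcons T n (a : T) (v : 'I_n -> T) (i : 'I_n.+1) : T :=
  if unlift ord0 i is Some j then v j else a.

Definition vcat T n m (v : 'I_n -> T) (w : 'I_m -> T) (i : 'I_(n + m)) : T :=
  match fintype.split i with inl j => v j | inr k => w k end.

Definition vempty T (i : 'I_0) : T := False_rect T (notF (ltn_ord i)).

(* [sat A phi v]: the substructure of M with universe A satisfies phi(v),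
   for v a tuple from A.  As the language is relational, every subset A of M
   is the universe of a substructure.  *)
Fixpoint sat L (M : structure L) (A : set M) n (phi : formula L n) :
    ('I_n -> M) -> Prop :=
  match phi in formula _ n return ('I_n -> M) -> Prop with
  | Eq _ i j => fun v => v i = v j
  | InP _ i => fun v => predP (v i)
  | Rel _ R t => fun v => interp (fun k : 'I_(arity R) => v (tnth t k))
  | Bot _ => fun _ => False
  | Imp _ f g => fun v => sat A f v -> sat A g v
  | All _ f => fun v => forall a, A a -> sat A f (vcons a v)
  end.

Definition holds L (M : structure L) n (phi : formula L n) (v : 'I_n -> M) :=
  sat [set: M] phi v.

Definition Th L (M : structure L) (A : set M) : set (sentence L) :=
  [set sigma | sat A sigma (@vempty M)].

Definition models L (M : structure L) (T : set (sentence L)) :=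
  T `<=` Th [set: M].

(* Complete theories are taken to be deductively closed, so that the cardinal
   |T| is that of the set of all formulas, |L| + aleph_0.  *)
Definition complete_theory L (T : set (sentence L)) :=
  (exists M : structure L, models M T) /\
  forall sigma, T sigma \/ T (Neg sigma).

Definition P_infinite L (T : set (sentence L)) :=
  forall M : structure L, models M T -> infinite_set (@predP L M).

Definition quantifier_elimination L (T : set (sentence L)) :=
  forall n (phi : formula L n), exists2 psi : formula L n,
    quantifier_free psi &
    forall M : structure L, models M T ->
    forall v : 'I_n -> M, holds phi v <-> holds psi v.

Definition card_lt T U (A : set T) (B : set U) : Prop :=
  A #<= B /\ ~ (B #<= A).

(* Cardinals are represented by types. *)
Definition inaccessible (kappa : Type) :=
  [/\ card_lt [set: nat] [set: kappa],
      forall X : set kappa, card_lt X [set: kappa] ->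
        card_lt [set Y : set kappa | Y `<=` X] [set: kappa] &
      forall (X : set kappa) (F : kappa -> set kappa),
        card_lt X [set: kappa] ->
        (forall i, X i -> card_lt (F i) [set: kappa]) ->
        card_lt (\bigcup_(i in X) F i) [set: kappa] ].

Definition small (kappa : Type) T (A : set T) := card_lt A [set: kappa].

(* Formulas phi(x, b) in n free variables x with parameters b from M. *)
Record pformula L (M : structure L) n := PFormula {
  nparam : nat;
  body : formula L (n + nparam);
  param : 'I_nparam -> M }.

Section Monster.
Variables (L : language) (C : structure L).

Definition tuple_in (A : set C) n (v : 'I_n -> C) := forall i, A (v i).

Definition over (A : set C) n (phi : pformula C n) :=
  tuple_in A (@param L C n phi).

Definition psat n (phi : pformula C n) (v : 'I_n -> C) :=
  holds (body phi) (vcat v (@param L C n phi)).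

Definition realizes n (v : 'I_n -> C) (p : set (pformula C n)) :=
  forall phi, p phi -> psat phi v.

Definition saturated (kappa : Type) :=
  forall (A : set C) n (p : set (pformula C n)),
    small kappa A -> p `<=` over A (n := n) ->
    (forall q, finite_set q -> q `<=` p -> exists v, realizes v q) ->
    exists v, realizes v p.

Definition automorphism (g : C -> C) :=
  [/\ bijective g,
      forall a, predP (g a) <-> predP a &
      forall (R : symbol L) (v : 'I_(arity R) -> C),
        interp (g \o v) <-> interp v ].

Definition strongly_homogeneous (kappa : Type) :=
  forall (A : set C) (f : C -> C), small kappa A ->
    (forall n (phi : formula L n) v,
       tuple_in A v -> holds phi v <-> holds phi (f \o v)) ->
    exists2 g, automorphism g & forall a, A a -> g a = f a.

(* "Large enough" is fixed as strongly inaccessible: the small sets are then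
   closed under all the usual cardinal operations.  *)
Definition monster_model (T : set (sentence L)) (kappa : Type) :=
  [/\ models C T, inaccessible kappa, saturated kappa &
      strongly_homogeneous kappa].

Definition PC : set C := @predP L C.

Definition Ppart (A : set C) : set C := A `&` PC.

(* [definable_over B X]: X is definable in C with parameters from B. *)
Definition definable_over (B : set C) n (X : set ('I_n -> C)) :=
  exists m (phi : formula L (n + m)) (b : 'I_m -> C),
    tuple_in B b /\ X = [set a | holds phi (vcat a b)].

(* "Subset of P" is read as "subset of a finite power of P". *)
Definition P_stably_embedded :=
  forall n (X : set ('I_n -> C)), X `<=` tuple_in PC (n := n) ->
    definable_over [set: C] X -> definable_over PC X.

Definition P_no_new_structure :=
  forall n (phi : formula L n),
    [set a : 'I_n -> C | holds phi a] `<=` tuple_in PC (n := n) ->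
    exists psi : formula L n,
      [set a : 'I_n -> C | holds phi a] =
      [set a : 'I_n -> C | tuple_in PC a /\ sat PC psi a].

Definition models_TP (N : set C) := N `<=` PC /\ Th PC `<=` Th N.

Definition elementary (M : set C) :=
  forall n (phi : formula L n) v,
    tuple_in M v -> sat M phi v <-> holds phi v.

(* By convention all models of T are small elementary submodels of C. *)
Definition model (kappa : Type) (M : set C) := small kappa M /\ elementary M.

Definition complete_set (A : set C) :=
  forall n m (psi : formula L (n + m)) (b : 'I_m -> C), tuple_in A b ->
    (exists a : 'I_n -> C, tuple_in PC a /\ holds psi (vcat a b)) ->
    exists a : 'I_n -> C, tuple_in (PC `&` A) a /\ holds psi (vcat a b).

Definition tp n (c : 'I_n -> C) (A : set C) : set (pformula C n) :=
  [set phi | over A phi /\ psat phi c].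

(* Finite tuples have arbitrary length, whence the dependent pairs. *)
Definition Sstar (A : set C) : set {n : nat & set (pformula C n)} :=
  [set p | exists n (c : 'I_n -> C),
     [/\ PC `&` (A `|` range c) = PC `&` A,
         complete_set (A `|` range c) &
         p = existT _ n (tp c A)] ].

Definition elem_equiv (A A' : set C) := Th A = Th A'.

(* [set f : T -> C | range f `<=` A] has cardinality |A|^|T|. *)
Definition stable (T : set (sentence L)) (kappa : Type) (A : set C) :=
  forall A' : set C, small kappa A' -> elem_equiv A' A ->
    Sstar A' #<= [set f : T -> C | range f `<=` A'].

Definition fully_stable (T : set (sentence L)) (kappa : Type) (N : set C) :=
  forall A : set C, small kappa A -> complete_set A -> Ppart A = N ->
    stable T kappa A.

Definition existence_property (kappa : Type) (A : set C) :=
  exists M : set C, [/\ model kappa M, A `<=` M & Ppart M = Ppart A].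

Definition full_existence_property (kappa : Type) (N : set C) :=
  forall A : set C, small kappa A -> complete_set A -> Ppart A = N ->
    existence_property kappa A.

(* |M| <= |A| + aleph_0 *)
Definition card_le_plus_aleph0 (M A : set C) : Prop :=
  M #<= [set s : C + nat | if s is inl a then A a else True].

Definition implies n (r q : set (pformula C n)) :=
  forall v, realizes v r -> realizes v q.

Definition restrict n m (p : set (pformula C n)) (phi : formula L (n + m)) :=
  p `&` [set psi | exists c : 'I_m -> C,
                     psi = PFormula phi c \/ psi = PFormula (Neg phi) c].

Definition locally_isolated n (p : set (pformula C n)) :=
  forall m (phi : formula L (n + m)),
    exists2 theta, p theta & implies [set theta] (restrict p phi).

Definition aleph1_isolated n (p : set (pformula C n)) :=
  exists r : set (pformula C n), [/\ r `<=` p, countable r & implies r p].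

(* The ordinal alpha is represented by a well-ordered type (I, le). *)
Definition constructible (isolated : set (pformula C 1) -> Prop)
    (A M : set C) :=
  exists (I : eqType) (le : rel I) (d : I -> C),
    [/\ well_order le,
        M = A `|` range d &
        forall i, isolated (tp (fun _ : 'I_1 => d i)
                     (A `|` d @` [set j | le j i && (j != i)])) ].

Definition locally_constructible := constructible (@locally_isolated 1).

Definition aleph1_constructible := constructible (@aleph1_isolated 1).

End Monster.

(* Main.v *)
From Stdlib Require Import Eqdep_dec.
Require Import Defs.
From mathcomp Require Import all_boot all_order.
From mathcomp Require Import all_classical.
From mathcomp Require Import wochoice.

(* The heart of the matter is that over a complete stable set [A] every
   consistent formula can be strengthened to one deciding all instances
   [phi(x, c)], [c] in [A], of a given formula [phi].  Otherwise every condition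
   (a nonempty [A]-definable set) below some [D0] is split by an instance of
   [phi].  One then grows a tree of conditions which, along each branch, are
   alternately split by an instance of [phi] and strengthened so as to contain a
   witness in [P] for each given existential requirement over [A] (one is found
   in [A], which is complete), unless that requirement is refuted.  Only finitely
   many steps are run inside [A].  An ultraproduct of these finite runs, realized in the
   monster model, is a tree of height [mu], the least ordinal with
   [2^mu > 2^aleph_0], over some [A' == A] with [|A'| <= 2^aleph_0].  Its
   [2^mu] branches yield distinct elements of [S_*(A')], and as
   [|A'|^aleph_0 <= 2^aleph_0], [A] is not stable.  This replaces the rank of
   the paper, and saturated models of prescribed size are never needed.

   As there are countably many formulas, the strengthening can be iterated
   [omega] times, so locally isolated types are dense over [A].  If [tp(d/A)] is
   locally isolated then [A + d] is again complete with the same part in [P]: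
   a formula isolating the [psi]-type of [d] is compatible with a witness of
   [psi] in [A], hence contains it.  A transfinite construction with
   book-keeping therefore reaches a model. *)

Set Implicit Arguments.
Unset Strict Implicit.
Unset Printing Implicit Defensive.

Local Open Scope classical_set_scope.
Local Open Scope card_scope.

(** * Cardinal arithmetic *)

Definition injects (T U : Type) := exists f : T -> U, injective f.

Lemma existT_inj (T : eqType) (P : T -> Type) x (a b : P x) :
  existT P x a = existT P x b -> a = b.
Proof. exact: (inj_pair2_eq_dec _ (@eq_comparable T)). Qed.

Lemma injects_trans T U V : injects T U -> injects U V -> injects T V.
Proof. by move=> [f fi] [g gi]; exists (g \o f); apply: inj_comp. Qed.

Lemma injects_prod T U T' U' :
  injects T T' -> injects U U' -> injects (T * U) (T' * U').
Proof.
move=> [f fi] [g gi]; exists (fun x => (f x.1, g x.2)).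
by move=> [a b] [c d] /= [] /fi-> /gi->.
Qed.

Lemma injects_sum T U T' U' :
  injects T T' -> injects U U' -> injects (T + U) (T' + U').
Proof.
move=> [f fi] [g gi].
exists (fun x => match x with inl a => inl (f a) | inr b => inr (g b) end).
by move=> [a|a] [b|b] //= [] => [/fi|/gi] ->.
Qed.

Lemma injects_option T T' : injects T T' -> injects (option T) (option T').
Proof. by move=> [f fi]; exists (omap f) => -[a|] [b|] //= [/fi->]. Qed.

Lemma injects_fun T U V : injects U V -> injects (T -> U) (T -> V).
Proof.
move=> [f fi]; exists (fun g => f \o g) => g h /funeqP e.
by apply/funext => x; apply: fi; apply: e.
Qed.

Lemma injects_surj T U : injects T U -> T -> exists g : U -> T, forall t, exists u, g u = t.
Proof.
move=> [f fi] t0; exists (fun u => if pselect (exists t, f t = u) is left e then projT1 (cid e) else t0).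
move=> t; exists (f t); case: pselect => [e|[]]; last by exists t.
by apply: fi; case: (cid e).
Qed.


Lemma card_le_set_type T U (A : set T) (B : set U) : A #<= B <-> injects A B.
Proof.
split=> [/card_leP/injfunPex[f _ fi]|[f fi]].
  by exists f => x y; apply: fi; rewrite inE.
by apply/card_leP/injfunPex; exists f => // x y _ _ /fi.
Qed.

Lemma card_le_fun T U (A : set T) (B : set U) (f : T -> U) :
  (forall x, A x -> B (f x)) -> (forall x y, A x -> A y -> f x = f y -> x = y) ->
  A #<= B.
Proof.
move=> fAB fi; apply/card_le_set_type.
exists (fun x : A => SigSub (mem_set (fAB _ (set_mem (valP x))))) => x y [].
by move=> /fi e; apply/val_inj/e; apply: set_mem; apply: valP.
Qed.

Lemma card_le_setT T U : [set: T] #<= [set: U] <-> injects T U.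
Proof.
split=> [/card_le_set_type[f fi]|[f fi]]; last first.
  by apply: (@card_le_fun _ _ _ _ f) => // x y _ _ /fi.
exists (fun x => val (f (SigSub (mem_set (I : [set: T] x))))) => x y /val_inj.
by move/fi => [].
Qed.

Lemma card_le_setTr T U (A : set T) : A #<= [set: U] -> injects {x | A x} U.
Proof.
move=> /card_le_set_type[f fi].
exists (fun x => val (f (SigSub (mem_set (svalP x))))) => x y /val_inj/fi[].
by case: x y => [x Ax] [y Ay] /= e; apply: eq_exist.
Qed.

Lemma card_le_surj T U (B : set T) (g : U -> T) :
  (forall t, B t -> exists u, g u = t) -> B #<= [set: U].
Proof.
move=> gB; apply: (@card_le_trans _ _ _ (g @` [set: U])); last exact: card_image_le.
by apply: subset_card_le => t /gB[u <-]; exists u.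
Qed.

(** Zorn's lemma on graphs of partial injections: a maximal one that is neither total nor onto could
    take one more pair. *)
Lemma injects_total T U : injects T U \/ injects U T.
Proof.
pose P (G : set (T * U)) := forall p q, G p -> G q -> (p.1 = q.1 <-> p.2 = q.2).
have [F FP Ft|G [PG Gmax]] := @Zorn_bigcup _ P.
  move=> p q [X FX Xp] [Y FY Yq].
  have [/(_ p Xp) Yp|/(_ q Yq) Xq] := Ft X Y FX FY.
  - exact: (FP Y).
  - exact: (FP X).
have [t|nT] := pselect (forall t, exists u, G (t, u)).
  left; have [f fG] := choice t; exists f => x y e.
  by apply/(PG _ _ (fG x) (fG y)).
have [u|nU] := pselect (forall u, exists t, G (t, u)).
  right; have [f fG] := choice u; exists f => x y e.
  by apply/(PG _ _ (fG x) (fG y)).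
have [t nt] := (existsNP _).2 nT; have [u nu] := (existsNP _).2 nU.
exfalso; apply: (Gmax (G `|` [set (t, u)])).
  split; first by left.
  by move=> /(_ (t, u)) h; apply: nt; exists u; apply: h; right.
have N p : G p -> p.1 <> t /\ p.2 <> u.
  by case: p => a b Gp; split=> /= e; subst; [apply: nt; exists b|apply: nu; exists a].
move=> p q [Gp|->] [Gq|->] //=; first exact: PG.
  by have [] := N _ Gp; split.
by have [n1 n2] := N _ Gq; split=> /esym.
Qed.

(** Zorn's lemma on graphs of injections [X * X -> X], with [X] a subset of [Z] containing a fixed
    copy of [nat]; for a maximal graph, [X] has the size of [Z]. *)
Lemma infinite_square Z : injects nat Z -> injects (Z * Z) Z.
Proof.
move=> [w wi].
have [pr pri] : injects (nat * nat) nat.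
  by exists pickle; apply: pcan_inj pickleK.
pose G0 : set (Z * Z * Z) := [set (w k.1, w k.2, w (pr k)) | k in [set: nat * nat]].
pose dom (G : set (Z * Z * Z)) x := exists z, G (x, x, z).
pose Q (G : set (Z * Z * Z)) :=
  [/\ forall p q, G p -> G q -> (p.1 = q.1 <-> p.2 = q.2),
      forall p, G p -> [/\ dom G p.1.1, dom G p.1.2 & dom G p.2] &
      forall x y, dom G x -> dom G y -> exists z, G (x, y, z)].
have QG0 : Q G0.
  have dw k : dom G0 (w k) by exists (w (pr (k, k))); exists (k, k).
  split.
  - move=> _ _ [[a b] _ <-] [[c d] _ <-] /=; split=> [[/wi-> /wi->//]|].
    by move/wi/pri => [-> ->].
  - by move=> _ [[a b] _ <-] /=; split.
  - move=> _ _ [_ [k _ [<- _ _]]] [_ [l _ [<- _ _]]].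
    by exists (w (pr (k.1, l.1))), (k.1, l.1).
(* Keeping the seed [G0] apart makes the empty chain admissible in [Zorn_bigcup]. *)
pose P H := Q (G0 `|` H).
have dom_mono G H x : G `<=` H -> dom G x -> dom H x.
  by move=> GH [z /GH]; exists z.
have [F FP Ft|H [PH Hmax]] := @Zorn_bigcup _ P.
  have [->|/set0P[X0 FX0]] := eqVneq F set0.
    by rewrite /P bigcup_set0 setU0.
  have up p : (G0 `|` \bigcup_(X in F) X) p -> exists2 X, F X & (G0 `|` X) p.
    by case=> [Gp|[X FX Xp]]; [exists X0 => //; left|exists X => //; right].
  have up2 p q : (G0 `|` \bigcup_(X in F) X) p -> (G0 `|` \bigcup_(X in F) X) q ->
      exists2 X, F X & (G0 `|` X) p /\ (G0 `|` X) q.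
    move=> /up[X FX Xp] /up[Y FY Yq].
    have [XY|YX] := Ft X Y FX FY.
      by exists Y => //; split=> //; case: Xp => [|/XY]; [left|right].
    by exists X => //; split=> //; case: Yq => [|/YX]; [left|right].
  have sub X : F X -> G0 `|` X `<=` G0 `|` \bigcup_(X in F) X.
    by move=> FX p [Gp|Xp]; [left|right; exists X].
  split.
  - by move=> p q Up Uq; have [X /FP[h _ _] []] := up2 _ _ Up Uq; apply: h.
  - move=> p /up[X FX Xp]; have [_ h _] := FP _ FX.
    by have [d1 d2 d3] := h _ Xp; split; apply: dom_mono (sub _ FX) _.
  - move=> x y [z xz] [z' yz']; have [X FX [h1 h2]] := up2 _ _ xz yz'.
    have [_ _ /(_ x y)[||t ht]] := FP _ FX; [by exists z|by exists z'|].
    by exists t; apply: sub FX _ ht.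
pose G := G0 `|` H; have [Gf Gd Gt] : Q G by [].
pose X := {x | dom G x}.
have [f fG] : exists f : X * X -> X, forall p, G (sval p.1, sval p.2, sval (f p)).
  have h (p : X * X) : exists z : X, G (sval p.1, sval p.2, sval z).
    case: p => [[x dx] [y dy]] /=; have [z xyz] := Gt x y dx dy.
    by have [_ _ dz] := Gd _ xyz; exists (exist _ z dz).
  by have [f hf] := choice h; exists f.
have fi : injective f.
  move=> p q e; have := Gf _ _ (fG p) (fG q); rewrite /= e => -[_ /(_ erefl)].
  case: p q {e} => [[a ?] [b ?]] [[c ?] [d ?]] /= [ac bd].
  by congr pair; apply: eq_exist.
have wX k : dom G (w k).
  by exists (w (pr (k, k))); left; exists (k, k).
pose x_ k : X := exist _ (w k) (wX k).
have x_i : injective x_ by move=> j k [/wi].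
have XXX : injects (X * X) X by exists f.
have X3 : injects (X + X) X.
  apply: (injects_trans _ XXX).
  exists (fun s => match s with inl a => (x_ 0, a) | inr a => (x_ 1, a) end).
  by move=> [a|a] [b|b] /= e; have /x_i := congr1 fst e; have /= := congr1 snd e => // ->.
(* If the complement of [X] injects into [X], then [Z] injects into [X + X], hence into [X].
   Otherwise the complement holds a copy of [X], over which [G] is extended, against maximality. *)
have [ZX|[g gi]] := injects_total {z | ~ dom G z} X.
  have hZX : injects Z X.
    apply: (injects_trans _ X3).
    apply: injects_trans (injects_sum (_ : injects X X) ZX); last by exists id.
    exists (fun z => match pselect (dom G z) with
                     | left d => inl (exist _ z d) | right d => inr (exist _ z d) end).
    by move=> a b; case: pselect => da; case: pselect => db // [].
  apply: injects_trans (injects_prod hZX hZX) _.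
  apply: injects_trans XXX _.
  by exists sval => -[a ?] [b ?] /= e; apply: eq_exist.
pose u (s : bool) (x : X) : Z := if s then sval (g x) else sval x.
have ui s s' x x' : u s x = u s' x' -> (s, x) = (s', x').
  case: s s' => [] [] /= e.
  - by congr pair; apply: gi; apply: eq_sig_hprop => //; move=> *; apply: Prop_irrelevance.
  - by case: (g x) e => z nz /= e; case: nz; rewrite e; apply: svalP.
  - by case: (g x') e => z nz /= e; case: nz; rewrite -e; apply: svalP.
  - by congr pair; apply: eq_sig_hprop => //; move=> *; apply: Prop_irrelevance.
(* [u true] is the copy and [u false] is [X] itself. The three new blocks [(s, t)] of the square all
   go into the copy, told apart by the label [s + t.*2]. *)
pose code (s t : bool) (p : X * X) : X := f (x_ (s + t.*2)%N, f p).
pose E : set (Z * Z * Z) := [set q | exists s t p, (s || t) /\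
  q = (u s p.1, u t p.2, u true (code s t p))].
exfalso; apply: (Hmax (H `|` E)).
  split; first by left.
  move=> /(_ (u true (x_ 0), u true (x_ 0), u true (code true true (x_ 0, x_ 0)))) h.
  have /h Hx : (H `|` E) (u true (x_ 0), u true (x_ 0), u true (code true true (x_ 0, x_ 0))).
    by right; exists true, true, (x_ 0, x_ 0).
  have [/= d _ _] := Gd _ (or_intror Hx).
  by case: (g (x_ 0)) d.
have GE : G0 `|` (H `|` E) = G `|` E by rewrite setUA.
rewrite /P GE; have uF x : u false x = sval x by [].
clearbody u.
have domGE x : dom (G `|` E) x <-> exists s y, x = u s y.
  split=> [[z [/Gd[/= d _ _]|[s [t [p [_ [-> _ _]]]]]]]|[[] [y ->]]].
  - by exists false, (exist _ x d); rewrite uF.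
  - by exists s, p.1.
  - by exists (u true (code true true (y, y))); right; exists true, true, (y, y).
  - by exists (sval (f (y, y))); left; rewrite uF; apply: (fG (y, y)).
have Gu p : G p -> exists q : X * X, p = (u false q.1, u false q.2, u false (f q)).
  case: p => [[a b] c] Gp; have [/= da db _] := Gd _ Gp.
  exists (exist _ a da, exist _ b db); rewrite !uF /=; congr pair.
  by have [/(_ erefl)] := Gf _ _ Gp (fG (exist _ a da, exist _ b db)).
split.
- move=> p q [/Gu[a ->]|[s [t [a [st ->]]]]] [/Gu[b ->]|[s' [t' [b [st' ->]]]]] /=.
  + split=> [[/ui[e1] /ui[e2]]|/ui[/fi->]//].
    by case: a b e1 e2 => [? ?] [? ?] /= <- <-.
  + split=> [[/ui[s0 _] /ui[t0 _]]|/ui[]//].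
    by rewrite -s0 -t0 in st'.
  + split=> [[/ui[s0 _] /ui[t0 _]]|/ui[]//].
    by rewrite s0 t0 in st.
  + split=> [[/ui[-> e1] /ui[-> e2]]|/ui[/fi[/wi e /fi ->]]].
      by case: a b e1 e2 => [? ?] [? ?] /= -> ->.
    by case: s t s' t' e {st st'} => [] [] [] [].
- have D s y : dom (G `|` E) (u s y) by apply/domGE; exists s, y.
  by move=> p [/Gu[a ->]|[s [t [a [_ ->]]]]]; split; apply: D.
- move=> x y /domGE[s [a ->]] /domGE[t [b ->]].
  case st : (s || t).
    by exists (u true (code s t (a, b))); right; exists s, t, (a, b).
  case: s t st => [] [] // _.
  by exists (sval (f (a, b))); left; rewrite !uF; apply: (fG (a, b)).
Qed.

Lemma infinite_sum Z : injects nat Z -> injects (Z + Z) Z.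
Proof.
move=> wZ; apply: (injects_trans _ (infinite_square wZ)); have [w wi] := wZ.
exists (fun s => match s with inl a => (w 0, a) | inr a => (w 1, a) end).
by move=> [a|a] [b|b] /= e; have /wi := congr1 fst e; have /= := congr1 snd e => // ->.
Qed.

Lemma infinite_seq Z : injects nat Z -> injects (seq Z) Z.
Proof.
move=> wZ; have [f fi] := infinite_square wZ; have [w wi] := wZ.
apply: (injects_trans _ (infinite_square wZ)).
exists (fun s => (w (size s), foldr (fun a b => f (a, b)) (w 0) s)).
move=> s t [] /wi; elim: s t => [|a s IH] [|b t] //= [st] /fi[-> e].
by rewrite (IH t).
Qed.

(** * Well-orders and formulas *)

Section WellOrder.
Variables (I : eqType) (le : rel I).
Hypothesis wo : well_order le.

Definition slt (j i : I) := le j i && (j != i).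

Lemma wo_min (P : I -> Prop) : (exists i, P i) -> exists2 m, P m & forall j, P j -> le m j.
Proof.
move=> [i Pi]; have [|m [[mP mmin] _]] := wo (A := [pred i | `[< P i >]]).
  by exists i; apply/asboolP.
exists m; first by move/asboolP: mP.
by move=> j Pj; apply: mmin; apply/asboolP.
Qed.

Lemma wo_total i j : le i j \/ le j i.
Proof.
have [|m [->|->] h] := wo_min (P := fun k => k = i \/ k = j); first by exists i; left.
- by left; apply: h; right.
- by right; apply: h; left.
Qed.

Lemma wo_refl i : le i i.
Proof. by case: (wo_total i i). Qed.

Lemma wo_anti i j : le i j -> le j i -> i = j.
Proof.
move=> ij ji; have [|m [_ u]] := wo (A := [pred k | (k == i) || (k == j)]).
  by exists i; apply/orP; left.
have h k : (k == i) || (k == j) -> m = k.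
  move=> kij; apply: u; split=> // l /orP[]/eqP ->; case/orP: kij => /eqP -> //;
  exact: wo_refl.
by rewrite -(h i) ?eqxx// -(h j)// eqxx orbT.
Qed.

Lemma wo_trans i j k : le i j -> le j k -> le i k.
Proof.
move=> ij jk.
have [|m hm h] := wo_min (P := fun l => [\/ l = i, l = j | l = k]).
  by exists i; apply: Or31.
have mi : le m i by apply: h; apply: Or31.
have mj : le m j by apply: h; apply: Or32.
case: hm => e; subst m; first by apply: h; apply: Or33.
- by rewrite (wo_anti ij mi).
- by have e := wo_anti jk mj; subst k; rewrite (wo_anti ij mi) ?wo_refl.
Qed.

Lemma slt_le_trans i j k : slt i j -> le j k -> slt i k.
Proof.
move=> /andP[ij nij] jk; rewrite /slt (wo_trans ij jk); apply/eqP => e; subst k.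
by rewrite (wo_anti ij jk) eqxx in nij.
Qed.

Lemma slt_trans i j k : slt i j -> slt j k -> slt i k.
Proof. by move=> ij /andP[jk _]; apply: slt_le_trans jk. Qed.

Lemma sltxx i : slt i i = false.
Proof. by rewrite /slt eqxx andbF. Qed.

Lemma le_or_slt i j : le i j \/ slt j i.
Proof.
have [/eqP ->|ij] := boolP (i == j); first by left; apply: wo_refl.
by have [|ji] := wo_total i j; [left|right; rewrite /slt ji eq_sym].
Qed.

Lemma slt_wf : well_founded slt.
Proof.
move=> i; apply: contrapT => ni.
have [|m nm h] := wo_min (P := fun k => ~ Acc (fun j i : I => slt j i) k).
  by exists i.
apply: nm; constructor=> j jm.
apply: contrapT => nj; have := slt_le_trans jm (h _ nj).
by rewrite sltxx.
Qed.

(** Transfinite recursion with choice. Since [R i] only reads earlier values, it can be evaluated on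
    the part already built, filled up with [c0]. The conclusion is conditional because existence at
    [i] is usually proved from what [d] satisfies below [i]. *)
Lemma wo_choice (C : Type) (c0 : C) (R : I -> (I -> C) -> C -> Prop) :
  (forall i f g c, (forall j, slt j i -> f j = g j) -> R i f c -> R i g c) ->
  exists d, forall i, (exists c, R i d c) -> R i d (d i).
Proof.
move=> Rloc.
pose ext i (rec : forall j, slt j i -> C) j :=
  if pselect (slt j i) is left h then rec j h else c0.
pose F i (rec : forall j, slt j i -> C) :=
  if pselect (exists c, R i (ext i rec) c) is left e then projT1 (cid e) else c0.
pose d := Fix slt_wf (fun _ => C) F.
have dE i : d i = F i (fun j _ => d j).
  apply: (Fix_eq slt_wf (fun _ => C) F) => j f g fg.
  suff -> : f = g by [].
  by apply: functional_extensionality_dep => k; apply/funext => h; apply: fg.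
exists d => i [c Rc]; rewrite dE /F.
have ed j : slt j i -> d j = ext i (fun j _ => d j) j.
  by rewrite /ext; case: pselect.
case: pselect => [e|[]]; last by exists c; apply: Rloc Rc.
by case: (cid e) => x /= Rx; apply: Rloc Rx => j /ed.
Qed.

Lemma wo_max n (t : 'I_n.+1 -> I) : exists k, forall l, le (t l) (t k).
Proof.
elim: n t => [|n IH] t.
  by exists ord0 => l; rewrite (ord1 l) wo_refl.
have [k hk] := IH (t \o lift ord0).
have [h|h] := wo_total (t ord0) (t (lift ord0 k)).
- by exists (lift ord0 k) => l; case: (unliftP ord0 l) => [j ->|->//]; apply: hk.
- exists ord0 => l; case: (unliftP ord0 l) => [j ->|->]; last exact: wo_refl.
  by apply: wo_trans h; apply: hk.
Qed.

End WellOrder.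

(** * Tuples and their concatenation *)

Section Tuples.
Variable T : Type.

Lemma vcons0 n (a : T) (v : 'I_n -> T) : vcons a v ord0 = a.
Proof. by rewrite /vcons unlift_none. Qed.

Lemma vconsS n (a : T) (v : 'I_n -> T) i : vcons a v (lift ord0 i) = v i.
Proof. by rewrite /vcons liftK. Qed.

Lemma vcat_lshift n m (v : 'I_n -> T) (w : 'I_m -> T) i : vcat v w (lshift m i) = v i.
Proof. by rewrite /vcat (unsplitK (inl i)). Qed.

Lemma vcat_rshift n m (v : 'I_n -> T) (w : 'I_m -> T) i : vcat v w (rshift n i) = w i.
Proof. by rewrite /vcat (unsplitK (inr i)). Qed.

Lemma vcons_eta n (v : 'I_n.+1 -> T) : v = vcons (v ord0) (v \o lift ord0).
Proof.
by apply/funext => i; case: (unliftP ord0 i) => [j ->|->]; rewrite ?vcons0 ?vconsS.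
Qed.

Lemma vcons_vcat n m (v : 'I_n.+1 -> T) (w : 'I_m -> T) :
  vcat v w = vcons (v ord0) (vcat (v \o lift ord0) w) :> ('I_(n + m).+1 -> T).
Proof.
apply/funext => i; case: (unliftP ord0 i) => [j ->|->]; rewrite ?vcons0 ?vconsS.
  case: (split_ordP j) => k ->.
    rewrite vcat_lshift (_ : lift ord0 _ = lshift m (lift ord0 k)) ?vcat_lshift//.
    exact: val_inj.
  rewrite vcat_rshift (_ : lift ord0 _ = rshift n.+1 k) ?vcat_rshift//.
  exact: val_inj.
by rewrite (_ : ord0 = lshift m ord0) ?vcat_lshift//; apply: val_inj.
Qed.

Lemma vcat0 m (v : 'I_0 -> T) (w : 'I_m -> T) : vcat v w = w :> ('I_m -> T).
Proof.
apply/funext => i; have -> : i = rshift 0 i by apply: val_inj.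
rewrite vcat_rshift; congr w; exact: val_inj.
Qed.

Lemma vcat1 m (v : 'I_1 -> T) (w : 'I_m -> T) :
  vcat v w = vcons (v ord0) w :> ('I_m.+1 -> T).
Proof. by rewrite vcons_vcat vcat0. Qed.

End Tuples.

Lemma comp_vcons T U n (F : T -> U) a (v : 'I_n -> T) : F \o vcons a v = vcons (F a) (F \o v).
Proof.
by apply/funext => i; case: (unliftP ord0 i) => [j ->|->] /=; rewrite ?vcons0 ?vconsS.
Qed.

Lemma comp_vcat T U n m (F : T -> U) (v : 'I_n -> T) (w : 'I_m -> T) :
  F \o vcat v w = vcat (F \o v) (F \o w).
Proof.
by apply/funext => i; case: (split_ordP i) => k -> /=; rewrite ?vcat_lshift ?vcat_rshift.
Qed.

(** Gathers the occurrences of [y] in one variable: after renaming by [r], a formula with parameters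
    in a set and a point [y] becomes a formula in [y] with parameters in the set. *)
Lemma split_tuple X (Q : X -> Prop) (y : X) n (t : 'I_n -> X) :
  (forall k, t k = y \/ Q (t k)) ->
  exists m (u : 'I_m -> X) (r : 'I_n -> 'I_m.+1),
    (forall i, Q (u i)) /\ t = vcons y u \o r.
Proof.
elim: n t => [|n IH] t tQ.
  exists 0, t, (fun=> ord0); split=> [[]//|]; apply/funext => -[] //.
have [m [u [r [uQ e]]]] := IH (t \o lift ord0) (fun k => tQ _).
have [t0|t0] := tQ ord0.
  exists m, u, (vcons ord0 r); split=> //.
  by rewrite comp_vcons vcons0 -e -t0 -vcons_eta.
exists m.+1, (vcons (t ord0) u),
  (vcons (lift ord0 ord0) (vcons ord0 (fun j => lift ord0 (lift ord0 j)) \o r)).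
split=> [i|].
  by case: (unliftP ord0 i) => [j ->|->] /=; rewrite ?vcons0 ?vconsS.
rewrite comp_vcons vconsS vcons0 [LHS]vcons_eta e; congr vcons.
rewrite compA comp_vcons vcons0; congr (_ \o _); congr vcons.
by apply/funext => j /=; rewrite !vconsS.
Qed.

(** * Renaming of variables and definable sets *)

Section Formulas.
Variable L : language.

Fixpoint rename n (f : formula L n) : forall m, ('I_n -> 'I_m) -> formula L m :=
  match f in formula _ n return forall m, ('I_n -> 'I_m) -> formula L m with
  | Eq _ i j => fun m r => Eq L (r i) (r j)
  | InP _ i => fun m r => InP L (r i)
  | Rel _ R t => fun m r => @Rel L m R (map_tuple r t)
  | Bot _ => fun m r => Bot L m
  | Imp _ f g => fun m r => Imp (rename f r) (rename g r)
  | All _ f => fun m r => All (rename f (vcons ord0 (lift ord0 \o r)))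
  end.

Definition And n (f g : formula L n) := Neg (Imp f (Neg g)).
Definition Ex n (f : formula L n.+1) := Neg (All (Neg f)).

(** The bounded quantifier of the definition of completeness, applied to the first [n] variables. *)
Fixpoint ExP n m : formula L (n + m) -> formula L m :=
  match n return formula L (n + m) -> formula L m with
  | 0 => fun f => f
  | n.+1 => fun f : formula L (n + m).+1 => @ExP n m (Ex (And (InP L ord0) f))
  end.

(** Only the variable 0 is shared and the two parameter tuples stand side by side; this closes
    definable sets and types under intersection. *)
Definition and_params n m (f : formula L n.+1) (g : formula L m.+1) :
    formula L (n + m).+1 :=
  And (rename f (vcons ord0 (lift ord0 \o @lshift n m)))
      (rename g (vcons ord0 (lift ord0 \o @rshift n m))).

Variable C : structure L.
Implicit Types A B : set C.

Lemma sat_rename A n (f : formula L n) m (r : 'I_n -> 'I_m) v :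
  sat A (rename f r) v <-> sat A f (v \o r).
Proof.
elim: f m r v => //= {}n.
- move=> R t m r v.
  by under [X in interp X]eq_fun do rewrite tnth_map.
- by move=> f IHf g IHg m r v; rewrite IHf IHg.
- move=> f IH m r v; split=> h a Aa.
    move/(IH _ _ (vcons a v)): (h a Aa); rewrite comp_vcons vcons0.
    by congr sat; congr vcons; apply/funext => i /=; rewrite vconsS.
  apply/IH; rewrite comp_vcons vcons0; move: (h a Aa).
  by congr sat; congr vcons; apply/funext => i /=; rewrite vconsS.
Qed.

Lemma holds_rename n (f : formula L n) m (r : 'I_n -> 'I_m) (v : 'I_m -> C) :
  holds (rename f r) v <-> holds f (v \o r).
Proof. exact: sat_rename. Qed.

Lemma holds_neg n (f : formula L n) (v : 'I_n -> C) : holds (Neg f) v <-> ~ holds f v.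
Proof. by []. Qed.

Lemma holds_and n (f g : formula L n) (v : 'I_n -> C) :
  holds (And f g) v <-> holds f v /\ holds g v.
Proof.
split=> [h|[hf hg] h]; last exact: h.
by split; apply: contrapT => n1; apply: h => // hf.
Qed.

Lemma holds_ex n (f : formula L n.+1) (v : 'I_n -> C) :
  holds (Ex f) v <-> exists a, holds f (vcons a v).
Proof.
split=> [h|[a fa] h]; last exact: (h a I).
by apply: contrapT => n1; apply: h => a _ fa; apply: n1; exists a.
Qed.

Lemma holds_ExP n m (f : formula L (n + m)) (b : 'I_m -> C) :
  holds (ExP f) b <-> exists a : 'I_n -> C, tuple_in (@PC L C) a /\ holds f (vcat a b).
Proof.
elim: n f => [|n IH] f /=.
  split=> [h|[a [_]]]; last by rewrite vcat0.
  by exists (@vempty C); split=> [[]//|]; rewrite vcat0.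
rewrite IH; split=> [[a [aP /holds_ex[c /holds_and[cP fc]]]]|[a [aP fa]]].
  exists (vcons c a); split.
    move=> i; case: (unliftP ord0 i) => [j ->|->]; rewrite ?vconsS ?vcons0 //.
    by move: cP; rewrite /holds /= vcons0.
  move: fc; rewrite vcons_vcat vcons0; congr holds; congr vcons; congr vcat.
  by apply/funext => i /=; rewrite vconsS.
exists (a \o lift ord0); split; first by move=> i; apply: aP.
apply/holds_ex; exists (a ord0); apply/holds_and; split.
  by rewrite /holds /= vcons0; apply: aP.
by rewrite vcons_vcat in fa.
Qed.

Lemma holds_and_params n m (f : formula L n.+1) (g : formula L m.+1) (c : C)
    (t : 'I_n -> C) (u : 'I_m -> C) :
  holds (and_params f g) (vcons c (vcat t u)) <->
  holds f (vcons c t) /\ holds g (vcons c u).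
Proof.
rewrite holds_and !holds_rename !comp_vcons !vcons0.
have -> : vcons c (vcat t u) \o (lift ord0 \o @lshift n m) = t.
  by apply/funext => i /=; rewrite vconsS vcat_lshift.
have -> // : vcons c (vcat t u) \o (lift ord0 \o @rshift n m) = u.
by apply/funext => i /=; rewrite vconsS vcat_rshift.
Qed.

Definition def_over B (D : set C) := exists m (f : formula L m.+1) (a : 'I_m -> C),
  tuple_in B a /\ D = [set x | holds f (vcons x a)].

Lemma def_overT B : def_over B [set: C].
Proof.
exists 0, (Neg (Bot L 1)), (@vempty C); split; first by case.
by apply/seteqP; split=> x _ //; apply/holds_neg.
Qed.

Lemma tuple_in_vcat B n m (a : 'I_n -> C) (b : 'I_m -> C) :
  tuple_in B a -> tuple_in B b -> tuple_in B (vcat a b).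
Proof.
by move=> aB bB i; case: (split_ordP i) => k ->; rewrite ?vcat_lshift ?vcat_rshift.
Qed.

Lemma def_overI B D E : def_over B D -> def_over B E -> def_over B (D `&` E).
Proof.
move=> [n [f [a [aB ->]]]] [m [g [b [bB ->]]]].
exists (n + m)%N, (and_params f g), (vcat a b); split; first exact: tuple_in_vcat.
by apply/seteqP; split=> x /holds_and_params.
Qed.

(** Saturation in the form used below: by directedness, any finite part of the type follows from a
    single member of the family. *)
Lemma saturated_family kappa (satC : saturated C kappa) B (G : set (set C)) :
  small kappa B -> G `<=` def_over B -> G !=set0 ->
  (forall D E, G D -> G E -> exists2 F, G F & F `<=` D `&` E) ->
  (forall D, G D -> D !=set0) ->
  exists x, forall D, G D -> D x.
Proof.
move=> Bs GB [D0 GD0] Gdir Gne.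
pose p : set (pformula C 1) :=
  [set phi | Defs.over B phi /\ G [set x | psat phi (fun=> x)]].
have [q fq qp|v vp] := satC B 1 p Bs (fun phi h => h.1).
- suff [D GD Dq] : exists2 D, G D & forall x phi, D x -> q phi -> psat phi (fun=> x).
    by have [x Dx] := Gne _ GD; exists (fun=> x) => phi /(Dq _ _ Dx).
  have /(@finite_seqP {classic pformula C 1})[s qs] := fq.
  have {}qp : forall phi, phi \in s -> p phi by move=> phi ?; apply: qp; rewrite qs.
  suff [D GD Dq] : exists2 D, G D & forall x phi, D x -> phi \in s -> psat phi (fun=> x).
    by exists D => // x phi Dx; rewrite qs; apply: Dq.
  elim: s {qs} qp => [|phi s IH] sp; first by exists D0.
  have [|D GD Ds] := IH; first by move=> psi h; apply: sp; rewrite inE h orbT.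
  have [_ Gphi] := sp phi (mem_head _ _).
  have [F GF FD] := Gdir _ _ GD Gphi; exists F => // x psi /FD[Dx phix].
  by rewrite inE => /orP[/eqP->//|]; apply: Ds.
- exists (v ord0) => D GD; have [m [f [a [aB De]]]] := GB _ GD.
  have : psat (@PFormula L C 1 m f a) v.
    apply: vp; split=> //; move: GD; rewrite De; congr G.
    by apply/seteqP; split=> x; rewrite /= /psat /= vcat1.
  by rewrite /psat /= vcat1 De.
Qed.

End Formulas.

(** * Saturation and isolated points *)

Lemma card_lt_trans T U V (A : set T) (B : set U) (D : set V) :
  A #<= B -> card_lt B D -> card_lt A D.
Proof.
move=> AB [BD nDB]; split; first exact: card_le_trans BD.
by move=> DA; apply: nDB; apply: card_le_trans AB.
Qed.

Lemma ultra_not J (U : set_system J) (UU : UltraFilter U) (S : set J) :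
  U (~` S) <-> ~ U S.
Proof.
split=> [UnS US|nUS]; last by have [] := in_ultra_setVsetC S UU.
by have [j [Sj nSj]] := filter_ex (filterI US UnS); exact: nSj.
Qed.

(** * Ultraproducts realized in a saturated structure *)

Section Ultra.
Variables (L : language) (C : structure L) (kappa : Type).
Hypothesis satC : saturated C kappa.
Variables (J : Type) (U : set_system J).
Hypothesis UU : UltraFilter U.
Variables (X : Type) (val : J -> X -> C) (c0 : C).
Hypothesis Xsmall : small kappa [set: X].

(** The points [x] have a joint type in the ultrapower along [U]; saturation realizes it in [C], one
    point at a time along a well-order of [X], without forming the ultrapower. *)
Lemma ultra_embed : exists h : X -> C, forall n (f : formula L n) (t : 'I_n -> X),
  holds f (h \o t) <-> U [set j | holds f (val j \o t)].
Proof.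
have [le wo] := well_ordering_principle {classic X}.
pose lt := slt le.
(* [h x] has to realize, over the earlier values, the type that [x] has almost everywhere. *)
pose R (x : X) (h : X -> C) (c : C) := forall m (g : formula L m.+1) (t : 'I_m -> X),
  (forall i, lt (t i) x) -> U [set j | holds g (vcons (val j x) (val j \o t))] ->
  holds g (vcons c (h \o t)).
have [x f g c fg Rf|h hR] := @wo_choice {classic X} le wo C c0 R.
  move=> m phi t tx Ut; rewrite (_ : g \o t = f \o t); first exact: Rf.
  by apply/funext => i /=; rewrite fg//; apply: tx.
suff H : forall n (f : formula L n) (t : 'I_n -> X),
    U [set j | holds f (val j \o t)] -> holds f (h \o t).
  exists h => n f t; split; last exact: H.
  move=> hf; apply: contrapT => /(ultra_not UU) nU.
  by apply: (H _ (Neg f) _ nU).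
(* Induction on an upper bound [x] of the indices in [t]; every nonempty tuple has one. *)
have claim (x : X) : forall n (f : formula L n) (t : 'I_n -> X),
    (forall i, le (t i) x) ->
    U [set j | holds f (val j \o t)] -> holds f (h \o t).
  elim/(well_founded_ind (slt_wf wo)) : x => x IH.
  have below n (f : formula L n) (t : 'I_n -> X) : (forall i, lt (t i) x) ->
      U [set j | holds f (val j \o t)] -> holds f (h \o t).
    case: n f t => [|n] f t tx Ut.
      have [j /=] := filter_ex Ut; congr holds; apply/funext => -[] //.
    have [k tk] := @wo_max {classic X} le wo n t.
    exact: (IH (t k)).
  have Rx : R x h (h x).
    apply: hR.
    pose B := h @` [set y | lt y x].
    pose G D := exists m (g : formula L m.+1) (t : 'I_m -> X),
      [/\ forall i, lt (t i) x, U [set j | holds g (vcons (val j x) (val j \o t))] &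
          D = [set c | holds g (vcons c (h \o t))]].
    have [||||_ [m [g [t [tx Ut ->]]]]|c cG] := saturated_family satC (B := B) (G := G).
    - apply: card_lt_trans Xsmall; apply: card_le_trans (card_image_le _ _) _.
      exact: card_leT.
    - move=> _ [m [g [t [tx Ut ->]]]]; exists m, g, (h \o t); split=> // i.
      by exists (t i) => //; exact: tx.
    - exists [set c | holds (Neg (Bot L 1)) (vcons c (h \o @vempty X))].
      exists 0, (Neg (Bot L 1)), (@vempty X); split=> [[]//||//].
      by apply: filterS filterT => j _; apply/holds_neg.
    - move=> _ _ [m [g [t [tx Ut ->]]]] [n [f [u [ux Uu ->]]]].
      exists [set c | holds (and_params g f) (vcons c (h \o vcat t u))]; last first.
        by move=> c; rewrite /= comp_vcat => /holds_and_params.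
      exists (m + n)%N, (and_params g f), (vcat t u); split=> //.
        by move=> i; case: (split_ordP i) => k ->; rewrite ?vcat_lshift ?vcat_rshift.
      apply: filterS (filterI Ut Uu) => j /= h2.
      by rewrite comp_vcat; apply/holds_and_params.
    (* Nonemptiness is the formula with [x] quantified away, which mentions earlier indices only. *)
    - apply/holds_ex/below => //; apply: filterS Ut => j /= gj.
      by apply/holds_ex; exists (val j x).
    - exists c => m g t tx Ut; apply: (cG [set c | holds g (vcons c (h \o t))]).
      by exists m, g, t.
  move=> n f t tx Ut.
  have [k|m [u [r [ux tE]]]] := @split_tuple X (fun y => lt y x) x n t.
    have [->|tkx] := EM (t k = x); [by left|right].
    by rewrite /lt /slt tx; apply/eqP.
  have := Rx m (rename f r) u ux.
  have E (F : X -> C) : holds (rename f r) (vcons (F x) (F \o u)) <-> holds f (F \o t).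
    by rewrite holds_rename tE -comp_vcons.
  move=> h1; apply/(E h)/h1; apply: filterS Ut => j /= fj.
  exact/E.
move=> [|n] f t Ut.
  by have [j /=] := filter_ex Ut; congr holds; apply/funext => -[].
by have [k tk] := @wo_max {classic X} le wo n t; apply: (claim (t k)) Ut.
Qed.

End Ultra.

(** * Points isolated over a complete set *)

Section IsolatedPoints.
Variables (L : language) (C : structure L).
Implicit Types A B D : set C.

Definition decides B D m (f : formula L m.+1) := forall c : 'I_m -> C, tuple_in B c ->
  D `<=` [set x | holds f (vcons x c)] \/ D `<=` [set x | ~ holds f (vcons x c)].

(** Local isolation of the type of [d] over [B], phrased with definable sets; [isolated_tp] makes
    the translation. *)
Definition isolated_over B (d : C) := forall m (f : formula L m.+1),
  exists D, [/\ def_over B D, D d & decides B D f].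

(** Completeness of [B] is applied to the formula stating that some [x] in [D] satisfies [f], with
    the parameters of [D] adjoined to [u]. *)
Lemma complete_witness B (cB : complete_set B) D n k (f : formula L (n + k).+1)
    (u : 'I_k -> C) :
  def_over B D -> tuple_in B u ->
  (exists z : 'I_n -> C, tuple_in (@PC L C) z /\ exists2 x, D x & holds f (vcons x (vcat z u))) ->
  exists z : 'I_n -> C, tuple_in (@PC L C `&` B) z /\
    exists2 x, D x & holds f (vcons x (vcat z u)).
Proof.
move=> [l [g [a [aB ->]]]] uB.
(* [r] reassociates the variables, as [n + k + l] and [n + (k + l)] give different index types. *)
pose r : 'I_(n + k + l) -> 'I_(n + (k + l)) :=
  vcat (vcat (@lshift n _) (@rshift n _ \o @lshift k l)) (@rshift n _ \o @rshift k l).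
have E (z : 'I_n -> C) : holds (rename (Ex (and_params f g)) r) (vcat z (vcat u a)) <->
    exists2 x, holds g (vcons x a) & holds f (vcons x (vcat z u)).
  have -> : holds (rename (Ex (and_params f g)) r) (vcat z (vcat u a)) <->
      holds (Ex (and_params f g)) (vcat (vcat z u) a).
    rewrite holds_rename /r !comp_vcat.
    have -> : vcat z (vcat u a) \o @lshift n _ = z.
      by apply/funext => i /=; rewrite vcat_lshift.
    have -> : vcat z (vcat u a) \o (@rshift n _ \o @lshift k l) = u.
      by apply/funext => i /=; rewrite vcat_rshift vcat_lshift.
    have -> // : vcat z (vcat u a) \o (@rshift n _ \o @rshift k l) = a.
    by apply/funext => i /=; rewrite !vcat_rshift.
  rewrite holds_ex; split=> [[x /holds_and_params[]]|[x xg xf]]; exists x => //.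
  exact/holds_and_params.
move=> [z [zP /E zE]].
have [|z' [z'B /E z'E]] := cB n (k + l)%N (rename (Ex (and_params f g)) r)
  (vcat u a) (tuple_in_vcat uB aB).
  by exists z; split; [apply: zP|apply: zE].
by exists z'.
Qed.

Lemma split_variable n m k (psi : formula L (n + m)) (r : 'I_m -> 'I_k.+1) :
  exists f : formula L (n + k).+1, forall x (z : 'I_n -> C) (u : 'I_k -> C),
    holds f (vcons x (vcat z u)) <-> holds psi (vcat z (vcons x u \o r)).
Proof.
exists (rename psi (vcat (lift ord0 \o @lshift n k)
                         (vcons ord0 (lift ord0 \o @rshift n k) \o r))) => x z u.
rewrite holds_rename comp_vcat.
have -> : vcons x (vcat z u) \o (lift ord0 \o @lshift n k) = z.
  by apply/funext => i /=; rewrite vconsS vcat_lshift.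
rewrite compA comp_vcons vcons0.
have -> // : vcons x (vcat z u) \o (lift ord0 \o @rshift n k) = u.
by apply/funext => i /=; rewrite vconsS vcat_rshift.
Qed.

Lemma ExP_after n k (f : formula L (n + k).+1) :
  exists g : formula L k.+1, forall x (u : 'I_k -> C),
    holds g (vcons x u) <->
    exists z : 'I_n -> C, tuple_in (@PC L C) z /\ holds f (vcons x (vcat z u)).
Proof.
pose r : 'I_(n + k).+1 -> 'I_(n + k.+1) :=
  vcons (@rshift n k.+1 ord0) (vcat (@lshift n k.+1) (@rshift n k.+1 \o lift ord0)).
exists (ExP (rename f r)) => x u; rewrite holds_ExP.
suff E z : holds (rename f r) (vcat z (vcons x u)) <-> holds f (vcons x (vcat z u)).
  by split=> -[z [zP /E fz]]; exists z.
rewrite holds_rename /r comp_vcons comp_vcat /= vcat_rshift vcons0.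
have -> : vcat z (vcons x u) \o @lshift n k.+1 = z.
  by apply/funext => i /=; rewrite vcat_lshift.
have -> // : vcat z (vcons x u) \o (@rshift n k.+1 \o lift ord0) = u.
by apply/funext => i /=; rewrite vcat_rshift vconsS.
Qed.

(** [D] decides [f] for all parameters in [B], the witness [z] included. As one point of [D]
    satisfies [f] with [z], all of [D] does, and [d] with it. *)
Lemma isolated_witness B d (cB : complete_set B) (dB : isolated_over B d)
    n m (psi : formula L (n + m)) (b : 'I_m -> C) :
  tuple_in (B `|` [set d]) b ->
  (exists a : 'I_n -> C, tuple_in (@PC L C) a /\ holds psi (vcat a b)) ->
  exists a : 'I_n -> C, tuple_in (@PC L C `&` B) a /\ holds psi (vcat a b).
Proof.
move=> bBd [a [aP psia]].
have [k|k [u [r [uB bE]]]] := @split_tuple C B d m b.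
  by have [] := bBd k; [right|left].
have [f fE] := split_variable psi r.
have [D [Ddef Dd Ddec]] := dB _ f.
have [|z [zB [x Dx xz]]] := complete_witness (f := f) cB Ddef uB.
  by exists a; split=> //; exists d => //; apply/fE; rewrite -bE.
exists z; split=> //; rewrite bE; apply/fE.
have [|D1|D1] := Ddec (vcat z u); last 2 first.
- exact: D1.
- by have := D1 _ Dx.
by apply: tuple_in_vcat => // i; have [] := zB i.
Qed.

Lemma isolated_complete B d : complete_set B -> isolated_over B d ->
  complete_set (B `|` [set d]).
Proof.
move=> cB dB n m psi b bBd h; have [a [aB pa]] := isolated_witness cB dB bBd h.
by exists a; split=> // i; have [? ?] := aB i; split=> //; left.
Qed.

(** For [d] in [P], [isolated_witness] is applied to equality with [d]: the witness found in [B] is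
    [d]. *)
Lemma isolated_Ppart B d : complete_set B -> isolated_over B d ->
  Ppart (B `|` [set d]) = Ppart B.
Proof.
move=> cB dB; apply/seteqP; split=> x [xB xP]; last by split=> //; left.
split=> //; case: xB => [//|xd]; have {}xd : x = d := xd; subst x.
have [||a [aB]] := @isolated_witness B d cB dB 1 1 (Eq L (lshift 1 ord0) (rshift 1 ord0)) (fun=> d).
- by move=> _; right.
- by exists (fun=> d); split=> //; rewrite /holds /= vcat_lshift vcat_rshift.
- by rewrite /holds /= vcat_lshift vcat_rshift => <-; have [] := aB ord0.
Qed.

Lemma isolated_tp B d : isolated_over B d -> locally_isolated (tp (fun _ : 'I_1 => d) B).
Proof.
move=> dB m phi; have [D [[k [g [a [aB DE]]]] Dd Ddec]] := dB m phi.
have pE (v : 'I_1 -> C) j (f : formula L (1 + j)) (c : 'I_j -> C) :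
    psat (@PFormula L C 1 j f c) v <-> holds (n := j.+1) f (vcons (v ord0) c).
  by rewrite /psat /= vcat1.
exists (@PFormula L C 1 k g a).
  by split=> //; apply/pE; rewrite DE in Dd.
move=> v vD; have Dv : D (v ord0) by rewrite DE; apply/pE; apply: vD.
move=> psi [[cB cd] [c [e|e]]]; subst psi.
- have [//|D1|D1] := Ddec c; first by apply/pE; apply: D1.
  by case: (D1 _ Dd); exact: (pE (fun=> d) _ phi c).1 cd.
- have [//|D1|D1] := Ddec c; last by apply/pE; apply: D1.
  by case: ((pE (fun=> d) _ (Neg phi) c).1 cd); apply: D1 Dd.
Qed.

Definition dense_isolated B := forall D m (f : formula L m.+1),
  def_over B D -> D !=set0 ->
  exists E, [/\ def_over B E, E !=set0, E `<=` D & decides B E f].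

(** A decreasing sequence of definable sets, each deciding the next formula of an enumeration, has a
    common point by saturation. *)
Lemma dense_isolated_point kappa (satC : saturated C kappa) B :
  small kappa B -> countable [set: {m & formula L m.+1}] ->
  dense_isolated B ->
  forall D, def_over B D -> D !=set0 -> exists2 d, D d & isolated_over B d.
Proof.
move=> Bs Lc dB D Ddef Dne.
have [en enP] : exists en : nat -> {m & formula L m.+1}, forall t, exists u, en u = t.
  have /card_le_setT := Lc => h; apply: injects_surj h _.
  by exists 0; apply: Bot.
pose cond := {D | def_over B D /\ D !=set0}.
have ex_step (k : nat * cond) : exists E : cond,
    sval E `<=` sval k.2 /\ decides B (sval E) (projT2 (en k.1)).
  case: k => [k [E [Edef Ene]]] /=.
  have [F [Fd Fn FE Fdec]] := dB E _ (projT2 (en k)) Edef Ene.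
  by exists (exist _ F (conj Fd Fn)).
have [step stepP] := choice ex_step.
pose s := fix s k : cond := if k is k'.+1 then step (k', s k') else exist _ D (conj Ddef Dne).
have mono i j : (i <= j)%N -> sval (s j) `<=` sval (s i).
  elim: j => [|j IH]; first by rewrite leqn0 => /eqP ->.
  rewrite leq_eqVlt => /orP[/eqP ->//|/IH ij].
  by apply: subset_trans ij; have [] := stepP (j, s j).
pose G := [set E | exists k, E = sval (s k)].
have [|_ [k ->]||_ _ [i ->] [j ->]|_ [k ->]|d dG] := saturated_family satC (B := B) (G := G).
- exact: Bs.
- by case: (svalP (s k)).
- by exists D, 0.
- exists (sval (s (maxn i j))); first by exists (maxn i j).
  by move=> x sx; split; apply: mono sx; rewrite ?leq_maxl ?leq_maxr.
- by case: (svalP (s k)).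
exists d; first by apply: dG; exists 0.
move=> m f; have [k ek] := enP (existT _ m f).
exists (sval (s k.+1)); split; first by case: (svalP (s k.+1)).
  by apply: dG; exists k.+1.
by have [_] := stepP (k, s k); rewrite /= ek.
Qed.

End IsolatedPoints.

(** * A tree of types over an equivalent set *)

Section Tree.
Variables (L : language) (C : structure L) (kappa : Type).
Hypothesis satC : saturated C kappa.
Variables (A : set C) (a0 : C) (D0 : set C) (m0 : nat) (phi : formula L m0.+1).
Hypothesis cA : complete_set A.
Hypothesis Aa0 : A a0.
Hypothesis D0def : def_over A D0.
Hypothesis D0ne : D0 !=set0.
Hypothesis D0split : forall E, def_over A E -> E !=set0 -> E `<=` D0 -> ~ decides A E phi.

Variables (I : eqType) (leI : rel I).
Hypothesis woI : well_order leI.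
Hypothesis nomax : forall s, exists s', slt leI s s'.
Variable s0 : I.
Variables (K : eqType) (leK : rel K).
Hypothesis woK : well_order leK.
(** [dec s] lists, by codes in [K], the traces of branches on the levels up to [s]. Names refer to
    branches through these codes, since names indexed by full branches would be too many. *)
Variable dec : I -> K -> set I.
Hypothesis decP : forall s (eta : set I), exists k, forall s', leI s' s ->
  (dec s k s' <-> eta s').

(* [(s, nu, k, j)] names the [j]-th output of task [k] at level [s], along the
   branch whose restriction to the levels up to [s] is coded by [nu].  *)
Definition name := (I * K * K * nat)%type.
Definition level (x : name) : I := x.1.1.1.
Definition position (x : name) : I * K := (x.1.1.1, x.1.2).

(** [None] splits by an instance of [phi]. The left summand seeks a witness in [P] for the point of
    the branch, the right one a witness in [A] for an existential formula, which makes the limit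
    equivalent to [A]. Parameters are infinite sequences, cut to length by [prefix_tuple]. *)
Definition task := option
  ({p : nat * nat & formula L (p.1 + p.2).+1} * (nat -> name) +
   {m : nat & formula L m.+1} * (nat -> name)).

Variable e : K -> task.
Hypothesis eP : forall tau, exists k, e k = tau.
Variable k0 : K.
Hypothesis ek0 : e k0 = None.

Hypothesis names_small : small kappa [set: name].

Definition prefix_tuple T n (t : nat -> T) (i : 'I_n) : T := t i.
Arguments prefix_tuple {T n}.

Lemma prefix_tuple_comp T U n (F : T -> U) (t : nat -> T) :
  F \o prefix_tuple t = prefix_tuple (n := n) (F \o t).
Proof. by []. Qed.

Lemma prefix_tupleP T (x0 : T) n (u : 'I_n -> T) : exists t, prefix_tuple t = u.
Proof.
exists (fun k => if pselect (k < n)%N is left h then u (Ordinal h) else x0).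
apply/funext => i; rewrite /prefix_tuple; case: pselect => [h|[]//].
by congr u; apply: val_inj.
Qed.

Definition condition (D : set C) := [/\ def_over A D, D !=set0 & D `<=` D0].

(** [out] is the output of the task and [E b] the condition left on side [b]; only a splitting task
    tells the sides apart. *)
Definition fulfills (tau : task) (v : name -> C) (out : nat -> C) (E : bool -> set C) :=
  match tau with
  | None =>
      E true `<=` [set x | holds phi (vcons x (prefix_tuple out))] /\
      E false `<=` [set x | ~ holds phi (vcons x (prefix_tuple out))]
  | Some (inl (existT p f, t)) => forall b,
      E b `<=` [set x | ~ exists z : 'I_p.1 -> C, tuple_in (@PC L C) z /\
                  holds f (vcons x (vcat z (prefix_tuple (v \o t))))] \/
      tuple_in (@PC L C) (prefix_tuple (n := p.1) out) /\
      E b `<=` [set x | holds f (vcons x (vcat (prefix_tuple (n := p.1) out)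
                                            (prefix_tuple (v \o t))))]
  | Some (inr (existT m f, t)) =>
      (exists2 a, A a & sat A f (vcons a (prefix_tuple (v \o t)))) ->
      sat A f (vcons (out 0) (prefix_tuple (v \o t)))
  end.

(** For a witness in [P], either completeness provides one in [A] compatible with [D], or [D]
    already refutes the requirement. Splitting is possible by [D0split]. *)
Lemma step_exists D v tau : condition D -> (forall x, A (v x)) ->
  exists o : (nat -> C) * (bool -> set C),
    [/\ forall j, A (o.1 j), forall b, condition (o.2 b) /\ o.2 b `<=` D &
        fulfills tau v o.1 o.2].
Proof.
move=> cD vA; have [Ddef Dne DD0] := cD.
have sub E : def_over A E -> D `&` E !=set0 -> condition (D `&` E) /\ D `&` E `<=` D.
  move=> Edef DE; split; last exact: subIsetl.
  by split=> //; [apply: def_overI|apply: subset_trans DD0; apply: subIsetl].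
case: tau => [[[[p f] t]|[[m f] t]]|] /=.
- have [[z [zP [x0 Dx0 x0z]]]|nz] := pselect (exists z : 'I_p.1 -> C,
      tuple_in (@PC L C) z /\
      exists2 x, D x & holds f (vcons x (vcat z (prefix_tuple (v \o t))))).
    have uA : tuple_in A (prefix_tuple (n := p.2) (v \o t)) by move=> i; apply: vA.
    have [|z' [z'P [x Dx xz']]] := complete_witness (f := f) cA Ddef uA.
      by exists z; split=> //; exists x0.
    have [out outE] := prefix_tupleP a0 z'.
    (* Entries past the length are reset to [a0], since every output must lie in [A]. *)
    exists (fun j => if (j < p.1)%N then out j else a0,
            fun=> D `&` [set x | holds f (vcons x (vcat z' (prefix_tuple (v \o t))))]).
    have z'E : prefix_tuple (fun j => if (j < p.1)%N then out j else a0) = z'.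
      by rewrite -outE; apply/funext => i; rewrite /prefix_tuple ltn_ord.
    split=> /= [j|_|b].
    + case: ifP => // jp; have [_] := z'P (Ordinal jp).
      by rewrite -outE.
    + apply: sub; last by exists x.
      exists (p.1 + p.2)%N, f, (vcat z' (prefix_tuple (v \o t))); split=> //.
      by apply: tuple_in_vcat => // i; have [] := z'P i.
    + right; rewrite z'E; split=> [i|y []//]; by have [] := z'P i.
  exists (fun=> a0, fun=> D); split=> //= b; first by split.
  left => x Dx [z [zP xz]].
  by apply: nz; exists z; split=> //; exists x.
- have [[a Aa fa]|na] := pselect (exists2 a, A a & sat A f (vcons a (prefix_tuple (v \o t)))).
    by exists (fun=> a, fun=> D); split=> // b; split.
  by exists (fun=> a0, fun=> D); split=> // b; split.
- have : ~ decides A D phi by apply: D0split.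
  move=> /existsNP[c /not_implyP[cA' /not_orP[n1 n2]]].
  have [out outE] := prefix_tupleP a0 c.
  exists (fun j => if (j < m0)%N then out j else a0,
    fun b => D `&` if b then [set x | holds phi (vcons x c)]
                   else [set x | ~ holds phi (vcons x c)]).
  have cE : prefix_tuple (fun j => if (j < m0)%N then out j else a0) = c.
    by rewrite -outE; apply/funext => i; rewrite /prefix_tuple ltn_ord.
  split=> /= [j|b|].
  + by case: ifP => // jp; have := cA' (Ordinal jp); rewrite -outE.
  + apply: sub.
      case: b; first by exists m0, phi, c.
      by exists m0, (Neg phi), c.
    apply: contrapT => nE; case: b nE => nE.
      by apply: n2 => x Dx px; apply: nE; exists x.
    by apply: n1 => x Dx; apply: contrapT => px; apply: nE; exists x.
  + by rewrite cE; split=> x [].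
Qed.

Lemma step_function : exists step : set C * (name -> C) * task -> (nat -> C) * (bool -> set C),
  forall D v tau, condition D -> (forall x, A (v x)) ->
    [/\ forall j, A ((step (D, v, tau)).1 j),
        forall b, condition ((step (D, v, tau)).2 b) /\ (step (D, v, tau)).2 b `<=` D &
        fulfills tau v (step (D, v, tau)).1 (step (D, v, tau)).2].
Proof.
have H (i : set C * (name -> C) * task) : exists o : (nat -> C) * (bool -> set C),
    condition i.1.1 -> (forall x, A (i.1.2 x)) ->
    [/\ forall j, A (o.1 j), forall b, condition (o.2 b) /\ o.2 b `<=` i.1.1 &
        fulfills i.2 i.1.2 o.1 o.2].
  have [[cD vA]|n] := pselect (condition i.1.1 /\ forall x, A (i.1.2 x)).
    by have [o] := step_exists i.2 cD vA; exists o.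
  by exists (fun=> a0, fun=> D0) => cD vA; case: n.
have [step stepP] := choice H.
by exists step => D v tau cD vA; apply: (stepP (D, v, tau)).
Qed.

(** * Finite runs of the tree construction *)

Section Run.
Variable step : set C * (name -> C) * task -> (nat -> C) * (bool -> set C).
Hypothesis stepP : forall D v tau, condition D -> (forall x, A (v x)) ->
  [/\ forall j, A ((step (D, v, tau)).1 j),
      forall b, condition ((step (D, v, tau)).2 b) /\ (step (D, v, tau)).2 b `<=` D &
      fulfills tau v (step (D, v, tau)).1 (step (D, v, tau)).2].

(** The current values of the names, and the current condition along each branch. *)
Definition state := ((name -> C) * (set I -> set C))%type.

(* Only the task [k0], a splitting one, reads the branch.  *)
Definition bit (eta : set I) (w : I * K) := `[< eta w.1 >] && (w.2 == k0).

(** A task is carried out along all branches at once; a name at its position takes the value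
    computed along the branch coded in the name. *)
Definition update (st : state) (w : I * K) : state :=
  (fun x => if position x == w
            then (step (st.2 (dec x.1.1.1 x.1.1.2), st.1, e w.2)).1 x.2 else st.1 x,
   fun eta => (step (st.2 eta, st.1, e w.2)).2 (bit eta w)).

Definition run (l : seq (I * K)) : state := foldl update (fun=> a0, fun=> D0) l.

Lemma run_rcons l w : run (rcons l w) = update (run l) w.
Proof. by rewrite /run foldl_rcons. Qed.

Lemma run_inv l : (forall x, A ((run l).1 x)) /\ forall eta, condition ((run l).2 eta).
Proof.
elim/last_ind: l => [|l w [vA cD]]; first by split=> // eta; split.
rewrite run_rcons; split=> [x|eta] /=.
  by case: ifP => _ //; have [] := stepP (e w.2) (cD (dec x.1.1.1 x.1.1.2)) vA.
by have [_ /(_ (bit eta w))[]] := stepP (e w.2) (cD eta) vA.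
Qed.

(** A condition depends on its branch only through the splitting tasks already run. *)
Lemma run_agree l (eta eta' : set I) :
  (forall w, w \in l -> w.2 = k0 -> (eta w.1 <-> eta' w.1)) ->
  (run l).2 eta = (run l).2 eta'.
Proof.
elim/last_ind: l => [//|l w IH] h; rewrite run_rcons /=.
rewrite IH => [|w' w'l]; last by apply: h; rewrite mem_rcons inE w'l orbT.
congr (_.2 _); rewrite /bit; case: eqP => [wk|]; last by rewrite !andbF.
rewrite !andbT; apply: asbool_equiv_eq; apply: h => //.
by rewrite mem_rcons mem_head.
Qed.

Lemma run_sub l1 l2 eta : (run (l1 ++ l2)).2 eta `<=` (run l1).2 eta.
Proof.
elim/last_ind: l2 => [|l2 w IH]; first by rewrite cats0.
rewrite -rcons_cat run_rcons /=; apply: subset_trans IH.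
have [vA cD] := run_inv (l1 ++ l2).
by have [_ /(_ (bit eta w))[]] := stepP (e w.2) (cD eta) vA.
Qed.

Lemma run_val l1 l2 x : position x \notin l2 -> (run (l1 ++ l2)).1 x = (run l1).1 x.
Proof.
elim/last_ind: l2 => [|l2 w IH]; first by rewrite cats0.
rewrite mem_rcons inE negb_or => /andP[/negbTE xw xl2].
by rewrite -rcons_cat run_rcons /= xw IH.
Qed.

Definition leW (w w' : I * K) := slt leI w.1 w'.1 || (w.1 == w'.1) && leK w.2 w'.2.

Lemma leW_trans : transitive leW.
Proof.
move=> [s k] [s' k'] [s'' k'']; rewrite /leW /= => /orP[h|/andP[/eqP<- h]] /orP[h'|/andP[/eqP<- h']].
- by rewrite (slt_trans woI h h').
- by rewrite h.
- by rewrite h'.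
- by rewrite eqxx (wo_trans woK h h') orbT.
Qed.

Lemma leW_total : total leW.
Proof.
move=> [s k] [s' k']; rewrite /leW /slt /= [s' == s]eq_sym.
have [->|ss'] := eqVneq s s'.
  rewrite !andbF /=; apply/orP; exact: wo_total.
by rewrite !andbT /= !orbF; apply/orP; exact: wo_total.
Qed.

Lemma leW_level w w' : leW w w' -> leI w.1 w'.1.
Proof.
by move=> /orP[/andP[]//|/andP[/eqP-> _]]; apply: wo_refl.
Qed.

(** Each task of [i] is run exactly once and lower levels come first, so values at lower levels are
    final when a task starts. *)
Definition schedule (i : seq (I * K)) := sort leW (undup i).
Definition assignment (i : seq (I * K)) := (run (schedule i)).1.
Definition outcome (i : seq (I * K)) := (run (schedule i)).2.

Lemma assignment_in i x : A (assignment i x).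
Proof. exact: (run_inv (schedule i)).1. Qed.

Lemma outcome_ne i eta : outcome i eta !=set0.
Proof. by case: ((run_inv (schedule i)).2 eta). Qed.

(** If [nu] codes [eta] far enough, the outputs named by [nu] are those computed along [eta]. For
    [k0], agreement is asked strictly below [s], as the instance of [phi] is chosen before the
    branch turns. *)
Lemma run_task i s k nu (eta : set I) : (s, k) \in i ->
  (forall s', leI s' s -> (s' = s -> k <> k0) -> (dec s nu s' <-> eta s')) ->
  exists v out E, [/\ forall x, slt leI (level x) s -> v x = assignment i x,
    fulfills (e k) v out E,
    forall j, assignment i (s, nu, k, j) = out j &
    outcome i eta `<=` E (bit eta (s, k))].
Proof.
move=> wi agree; rewrite /assignment /outcome.
have uS : uniq (schedule i) by rewrite sort_uniq undup_uniq.
have sS : sorted leW (schedule i) by apply: sort_sorted leW_total _.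
have : (s, k) \in schedule i by rewrite mem_sort mem_undup.
move=> /splitPr def_l; case: def_l uS sS => l1 l2.
rewrite cat_uniq /= => /and3P[_ /norP[wl1 _] /andP[wl2 _]].
rewrite (sorted_pairwise leW_trans) pairwise_cat /= => /and3P[/allrelP lel1 _ /andP[/allP lel2 _]].
have [vA cD] := run_inv l1.
have := stepP (e k) (cD eta) vA.
set o := step _ => -[oA oc of_].
exists (run l1).1, o.1, o.2; split=> //.
(* Tasks from [(s, k)] on have level at least [s], so they do not touch names of lower level. *)
- move=> x xs; rewrite run_val// inE negb_or; apply/andP; split.
    by apply/eqP => /(congr1 fst) xE; move: xs; rewrite [level x]xE sltxx.
  apply/negP => /lel2/leW_level /= h; have := slt_le_trans woI xs h.
  by rewrite sltxx.
- move=> j; rewrite -cat_rcons run_val// run_rcons /= /position /= eqxx.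
  rewrite (run_agree (eta' := eta))// => w' w'l1 w'k.
  have := lel1 w' (s, k) w'l1 (mem_head _ _) => le'.
  apply: agree; first exact: (leW_level le').
  (* A splitting task at level [s] before [(s, k0)] would be [(s, k0)] itself, which occurs only
     once. *)
  move=> e1 e2; move/negP: wl1; apply; rewrite -e1 e2 -w'k.
  by case: (w') w'l1.
- by rewrite -cat_rcons; apply: subset_trans (@run_sub _ _ _) _; rewrite run_rcons.
Qed.

(** The cone filter on finite lists: along an ultrafilter containing it, every given task is
    performed in almost all runs. *)
Definition base : set_system (seq (I * K)) :=
  [set S | exists w : seq (I * K), forall i, {subset w <= i} -> S i].

Lemma base_proper : ProperFilter base.
Proof.
apply: Build_ProperFilter_ex; first by move=> S [w wS]; exists w; apply: wS.
split.
- by exists [::].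
- move=> S S' [w wS] [w' wS']; exists (w ++ w') => i h.
  by split; [apply: wS|apply: wS'] => x xw; apply: h; rewrite mem_cat xw ?orbT.
- by move=> S S' SS' [w wS]; exists w => i /wS /SS'.
Qed.

(** * Passage to the limit of the runs along an ultrafilter *)

Variable U : set_system (seq (I * K)).
Hypothesis UU : UltraFilter U.
Hypothesis baseU : base `<=` U.

Lemma U_task w : U [set i | w \in i].
Proof. by apply: baseU; exists [:: w] => i; apply; rewrite mem_head. Qed.

Variable h : name -> C.
Hypothesis hP : forall n (f : formula L n) (t : 'I_n -> name),
  holds f (h \o t) <-> U [set i | holds f (assignment i \o t)].

Let A' := range h.

(** Every task is available at each level and there is no last level, so a task can be placed above
    all names that it mentions. *)
Lemma task_position (tau : task) n (t : nat -> name) : exists s k,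
  e k = tau /\ forall i : 'I_n, slt leI (level (t i)) s.
Proof.
have [k ek] := eP tau.
case: n => [|n]; first by exists s0, k; split=> // -[].
have [l ml] := wo_max woI (fun i : 'I_n.+1 => level (t i)).
have [s ls] := nomax (level (t l)).
exists s, k; split=> // i; rewrite /slt; have := ml i => il.
have /andP[ls1 ls2] := ls; rewrite (wo_trans woI il ls1); apply/eqP => eq.
by move: ls; rewrite /slt -eq => /andP[h1 /eqP]; apply; apply: (wo_anti woI).
Qed.

(** The Los theorem for satisfaction in the substructures [A'] and [A]. If a universal formula fails
    in almost all runs, a task of the right summand of [task] yields a name for a counterexample. *)
Lemma los n (f : formula L n) (t : 'I_n -> name) :
  sat A' f (h \o t) <-> U [set i | sat A f (assignment i \o t)].
Proof.
elim: f t => {}n.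
- by move=> i j t; apply: (hP (Eq L i j)).
- by move=> i t; apply: (hP (InP L i)).
- by move=> R r t; apply: (hP (Rel r)).
- by move=> t; apply: (hP (Bot L n)).
- move=> f IHf g IHg t /=; rewrite IHf IHg; split=> [fg|].
    have [Uf|/(ultra_not UU) Uf] := EM (U [set i | sat A f (assignment i \o t)]).
      by apply: filterS (fg Uf) => i /= gi _.
    by apply: filterS Uf => i /= nf /nf.
  by move=> Ufg Uf; apply: filterS (filterI Ufg Uf) => i [/= fg /fg].
- move=> f IH t; split=> [all_f|Uall _ [x _ <-]]; last first.
    have E := IH (vcons x t); rewrite comp_vcons in E; apply/E.
    apply: filterS Uall => i /= fi.
    by rewrite comp_vcons; apply/fi/assignment_in.
  apply: contrapT => /(ultra_not UU) nU.
  have [u ut] := prefix_tupleP (s0, k0, k0, 0) t.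
  have [s [k [ek us]]] := task_position (Some (inr (existT _ n (Neg f), u))) n u.
  (* Any branch serves here, as this kind of requirement does not mention the branch. *)
  have [nu nuP] := decP s set0.
  pose x : name := (s, nu, k, 0).
  have := all_f (h x); rewrite -comp_vcons => /(_ _)/IH Ux.
  have {}Ux : U [set i | sat A f (assignment i \o vcons x t)] by apply: Ux; exists x.
  have [i [[fi nfi] wi]] := filter_ex (filterI (filterI Ux nU) (U_task (s, k))).
  have [v [out [E [vE]]]] := run_task wi (fun s' h _ => nuP s' h).
  rewrite ek /= => ful /(_ 0) outE _.
  have vt : prefix_tuple (v \o u) = assignment i \o t.
    by rewrite -ut prefix_tuple_comp; apply/funext => j; apply: vE.
  move: ful; rewrite vt -outE; apply; last by rewrite -comp_vcons.
  move/existsNP: nfi => [a /not_implyP[Aa nfa]]; by exists a.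
Qed.

(** The type to realize consists of the formulas that contain the outcome of [eta] in almost all
    runs; it is consistent since outcomes are nonempty. *)
Lemma branch_point (eta : set I) : exists d, forall m (f : formula L m.+1) (t : 'I_m -> name),
  U [set i | outcome i eta `<=` [set x | holds f (vcons x (assignment i \o t))]] ->
  holds f (vcons d (h \o t)).
Proof.
pose G D := exists m (f : formula L m.+1) (t : 'I_m -> name),
  U [set i | outcome i eta `<=` [set x | holds f (vcons x (assignment i \o t))]] /\
  D = [set x | holds f (vcons x (h \o t))].
have [||||_ [m [f [t [Ut ->]]]]|d dG] := saturated_family satC (B := A') (G := G).
- by apply: card_lt_trans names_small; apply: card_image_le.
- move=> _ [m [f [t [_ ->]]]]; exists m, f, (h \o t); split=> // i.
  by exists (t i).
- exists [set x | holds (Neg (Bot L 1)) (vcons x (h \o @vempty name))].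
  exists 0, (Neg (Bot L 1)), (@vempty name); split=> //.
  by apply: filterS filterT => j _ x _; apply/holds_neg.
- move=> _ _ [m [f [t [Ut ->]]]] [n [g [u [Uu ->]]]].
  exists [set x | holds (and_params f g) (vcons x (h \o vcat t u))]; last first.
    by move=> c; rewrite /= comp_vcat => /holds_and_params.
  exists (m + n)%N, (and_params f g), (vcat t u); split=> //.
  apply: filterS (filterI Ut Uu) => j /= [h1 h2] x cx.
  by rewrite /= comp_vcat; apply/holds_and_params; split; [apply: h1|apply: h2].
- apply/holds_ex/hP; apply: filterS Ut => i /= sub.
  by have [x cx] := outcome_ne i eta; apply/holds_ex; exists x; apply: sub.
- by exists d => m f t Ut; apply: (dG [set x | holds f (vcons x (h \o t))]); exists m, f, t.
Qed.

Variable d : set I -> C.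
Hypothesis dP : forall eta m (f : formula L m.+1) (t : 'I_m -> name),
  U [set i | outcome i eta `<=` [set x | holds f (vcons x (assignment i \o t))]] ->
  holds f (vcons (d eta) (h \o t)).

(** The task for this requirement, placed above its parameters, ends in almost all runs either with
    a witness in [P] named by [z], or with a refutation, which would pass to [d eta]. *)
Lemma branch_witness eta n m (psi : formula L (n + m)) (b : 'I_m -> C) :
  tuple_in (A' `|` range (fun _ : 'I_1 => d eta)) b ->
  (exists a : 'I_n -> C, tuple_in (@PC L C) a /\ holds psi (vcat a b)) ->
  exists a : 'I_n -> C, tuple_in (@PC L C `&` A') a /\ holds psi (vcat a b).
Proof.
move=> bA [a [aP pa]].
have [j|k [u [r [uA bE]]]] := @split_tuple C A' (d eta) m b.
  by have [|[_ _ <-]] := bA j; [right|left].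
have uA' (i : 'I_k) : exists x, h x = u i by have [x _ <-] := uA i; exists x.
have [t' ut'] := choice uA'.
have {uA uA'}ut' : u = h \o t' by apply/funext => i; rewrite /= ut'.
have [f fE] := @split_variable L C n m k psi r.
have [g gE] := @ExP_after L C n k f.
have [t tt'] := prefix_tupleP (s0, k0, k0, 0) t'.
have [s [k1 [ek us]]] := task_position (Some (inl (existT _ (n, k) f, t))) k t.
have [nu nuP] := decP s eta.
pose z : 'I_n -> name := prefix_tuple (fun j => (s, nu, k1, j)).
have [Uz|/(ultra_not UU) nUz] := EM (U [set i | tuple_in (@PC L C) (assignment i \o z) /\
    outcome i eta `<=` [set x | holds f (vcons x (vcat (assignment i \o z) (assignment i \o t')))]]).
  exists (h \o z); split=> [j|].
    split; last by exists (z j).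
    apply: (hP (InP L (@ord0 0)) (fun=> z j)).2; apply: filterS Uz => i [zP _].
    exact: zP.
  rewrite bE ut'; apply/fE; rewrite -comp_vcat; apply: dP; apply: filterS Uz => i [_] /=.
  by rewrite comp_vcat.
have : holds (Neg g) (vcons (d eta) (h \o t')).
  apply: dP; apply: filterS (filterI nUz (U_task (s, k1))) => i [/= ni wi] x cx.
  have [v [out [E [vE]]]] := run_task wi (fun s' h _ => nuP s' h).
  rewrite ek /= => ful outE cE.
  have vt : prefix_tuple (v \o t) = assignment i \o t'.
    by rewrite -tt' prefix_tuple_comp; apply/funext => j; apply: vE; apply: us.
  have outz : prefix_tuple (n := n) out = assignment i \o z.
    by apply/funext => j; rewrite /z /= /prefix_tuple outE.
  have [Eno|[outP Eyes]] := ful (bit eta (s, k1)).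
    by move=> /gE; rewrite -vt; apply: Eno; apply: cE.
  by case: ni; rewrite -outz; split=> // y /cE /Eyes; rewrite /= vt.
by case; apply/gE; exists a; split=> //; apply/fE; rewrite -ut' -bE.
Qed.

Lemma branch_Sstar eta : Sstar A' (existT _ 1 (tp (fun _ : 'I_1 => d eta) A')).
Proof.
exists 1, (fun=> d eta); split=> //.
- apply/seteqP; split=> x [xP xA]; last by split=> //; left.
  split=> //; case: xA => // -[_ _ xd]; subst x.
  have [||a [aA]] := @branch_witness eta 1 1 (Eq L (lshift 1 ord0) (rshift 1 ord0)) (fun=> d eta).
  + by move=> _; right; exists ord0.
  + by exists (fun=> d eta); split=> //; rewrite /holds /= vcat_lshift vcat_rshift.
  + by rewrite /holds /= vcat_lshift vcat_rshift => <-; have [] := aA ord0.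
- move=> n m psi b bA ex; have [a [aA pa]] := branch_witness bA ex.
  by exists a; split=> // i; have [? ?] := aA i; split=> //; left.
Qed.

(** The instance of [phi] used at level [s] depends on the branch below [s] only; the turn of the
    branch at [s] decides on which side [d eta] falls. *)
Lemma branch_splits eta s nu :
  (forall s', slt leI s' s -> (dec s nu s' <-> eta s')) ->
  holds phi (vcons (d eta) (h \o prefix_tuple (fun j => (s, nu, k0, j)))) <-> eta s.
Proof.
move=> agree; set z : 'I_m0 -> name := prefix_tuple _.
have H i : (s, k0) \in i -> exists E : bool -> set C,
    [/\ E true `<=` [set x | holds phi (vcons x (assignment i \o z))],
        E false `<=` [set x | ~ holds phi (vcons x (assignment i \o z))] &
        outcome i eta `<=` E `[< eta s >]].
  move=> wi; have [|v [out [E [vE]]]] := run_task (nu := nu) (eta := eta) wi.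
    by move=> s' h1 h2; apply: agree; rewrite /slt h1; apply/eqP => /h2.
  rewrite ek0 /bit /= eqxx andbT => -[E1 E2] outE cE; exists E.
  have <- // : prefix_tuple out = assignment i \o z.
  by apply/funext => j; rewrite /z /= /prefix_tuple outE.
have [etas|netas] := EM (eta s).
  split=> // _; apply: dP; apply: filterS (U_task (s, k0)) => i /H[E [E1 _]].
  by rewrite asboolT// => cE; apply: subset_trans E1.
split=> // ph; exfalso.
have : holds (Neg phi) (vcons (d eta) (h \o z)).
  apply: dP; apply: filterS (U_task (s, k0)) => i /H[E [_ E2]].
  by rewrite asboolF// => cE; apply: subset_trans E2.
by apply.
Qed.

(** At the first level where the branches part, one code serves both, so the same instance of [phi]
    is used there, and they take opposite sides of it. *)
Lemma branch_inj eta eta' :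
  tp (fun _ : 'I_1 => d eta) A' = tp (fun _ : 'I_1 => d eta') A' -> eta = eta'.
Proof.
move=> tpE; apply: contrapT => ne.
have [|s sP smin] := wo_min woI (P := fun s => ~ (eta s <-> eta' s)).
  apply: contrapT => /forallNP H; apply: ne; apply/seteqP.
  by split=> s; have /contrapT[] := H s.
have agr s' : slt leI s' s -> eta s' <-> eta' s'.
  by move=> ss; apply: contrapT => /smin h1; have := slt_le_trans woI ss h1; rewrite sltxx.
have [nu nuP] := decP s eta.
have dn s' : slt leI s' s -> dec s nu s' <-> eta s' by move=> /andP[h1 _]; apply: nuP.
have dn' s' : slt leI s' s -> dec s nu s' <-> eta' s'.
  by move=> h1; rewrite dn// agr.
apply: sP; rewrite -(branch_splits dn) -(branch_splits dn').
set z := h \o _.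
pose q : pformula C 1 := @PFormula L C 1 m0 phi z.
have qE eta1 : tp (fun _ : 'I_1 => d eta1) A' q <-> holds phi (vcons (d eta1) z).
  rewrite /tp /psat /= vcat1; split=> [[]//|hp]; split=> // i.
  by exists (prefix_tuple (fun j : nat => (s, nu, k0, j)) i).
by rewrite -!qE tpE.
Qed.

End Run.

Lemma tree_types : exists A1 : set C, [/\ A1 #<= [set: name], elem_equiv A1 A &
  exists p : set I -> {n : nat & set (pformula C n)},
    injective p /\ forall eta, Sstar A1 (p eta)].
Proof.
have [step stepP] := step_function.
have [U [UU baseU]] := ultraFilterLemma base_proper.
have [h hP] := ultra_embed satC UU (assignment step) a0 names_small.
have [d dP] := choice (branch_point stepP UU hP).
exists (range h); split.
- exact: card_image_le.
- have hE : h \o @vempty name = @vempty C by apply/funext => -[].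
  apply/seteqP; split=> sigma; rewrite /Th /= -hE.
    move/(los stepP UU baseU hP) => /filter_ex[i /=].
    by congr sat; apply/funext => -[].
  move=> As; apply/(los stepP UU baseU hP); apply: filterS filterT => i _ /=.
  by move: As; congr sat; apply/funext => -[].
- exists (fun eta => existT _ 1 (tp (fun _ : 'I_1 => d eta) (range h))); split.
    move=> eta eta' e1; have := existT_inj e1.
    exact: (branch_inj stepP UU baseU dP).
  by move=> eta; exact: (branch_Sstar stepP UU baseU hP dP).
Qed.

End Tree.

(** * The height of the tree *)

Lemma Cantor T : ~ injects (set T) T.
Proof.
move=> [f fi]; pose D : set T := [set x | exists2 Y, f Y = x & ~ Y x].
have nD : ~ D (f D) by move=> /[dup] DD [Y /fi -> /(_ DD)].
by apply: (nD); exists D.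
Qed.

Notation reals := (nat -> bool).

Lemma injects_nat_reals : injects nat reals.
Proof.
by exists (fun n m => m == n) => m n /(congr1 (@^~ m)); rewrite eqxx => /esym/eqP.
Qed.

Lemma injects_fun_reals T : injects T nat -> injects (T -> reals) reals.
Proof.
move=> [i ii].
exists (fun f n => `[< exists t k, pickle (i t, k) = n /\ f t k >]) => f g fg.
apply/funext => t; apply/funext => k.
have H (f1 : T -> reals) :
    `[< exists t' k', pickle (i t', k') = pickle (i t, k) /\ f1 t' k' >] = f1 t k.
  apply/asboolP/idP => [[t' [k' [/(pcan_inj pickleK)[/ii <- <-]]]]//|ft].
  by exists t, k.
by rewrite -(H f) -(H g); exact: (congr1 (@^~ (pickle (i t, k))) fg).
Qed.

(** The reals are well-ordered and [I] is the longest initial segment all of whose points [s] are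
    [good]: the segment up to [s] has at most continuum many subsets. [dec] lists these subsets by
    reals. *)
Lemma branching_order : exists (I : eqType) (le : rel I), [/\ well_order le,
  injects I reals /\ inhabited I, (forall s, exists s', slt le s s'),
  ~ injects (set I) reals &
  exists dec : I -> {classic reals} -> set I, forall s (eta : set I),
    exists k, forall s', le s' s -> (dec s k s' <-> eta s')].
Proof.
have RR := infinite_square injects_nat_reals.
have [leK wo] := well_ordering_principle {classic reals}.
pose good s := injects (set {x | leK x s}) reals.
pose S : pred {classic reals} := fun s => `[< forall x, leK x s -> good x >].
pose I : eqType := {s : {classic reals} | S s}.
pose le : rel I := fun s s' => leK (sval s) (sval s').
have goodI (s : I) : good (sval s).
  by have /asboolP := svalP s; apply; apply: wo_refl.
have nI : ~ injects (set I) reals.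
  have [all_S|/existsNP[s nSs]] := pselect (forall s, S s).
    apply: contra_not (@Cantor reals) => -[f fi].
    exists (fun Y => f [set s | Y (sval s)]) => Y Z /fi YZ.
    by apply/funext => x; have := congr1 (@^~ (exist _ x (all_S x))) YZ.
  have [|m nSm mmin] := wo_min wo (P := fun s => ~ S s); first by exists s.
  have ngm : ~ good m.
    move=> gm; apply: nSm; apply/asboolP => x xm.
    have [Sx|nSx] := EM (S x); last by rewrite (wo_anti wo xm (mmin _ nSx)).
    by have /asboolP := Sx; apply; apply: wo_refl.
  (* The segment up to the least excluded point [m] is [I] with [m] added: a subset of it is a
     subset of [I] and one bit, so [m] would be [good]. *)
  apply: contra_not ngm => h.
  apply: injects_trans _ (injects_trans (injects_prod h injects_nat_reals) RR).
  exists (fun Y => ([set s | exists h, Y (exist _ (sval s) h)],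
      if pselect (exists h, Y (exist _ m h)) is left _ then 1 else 0)) => Y Z [e1 e2].
  apply/seteqP.
  have H (Y1 Z1 : set {x | leK x m}) :
      [set s : I | exists h, Y1 (exist _ (sval s) h)] =
      [set s : I | exists h, Z1 (exist _ (sval s) h)] ->
      ((exists h, Y1 (exist _ m h)) -> (exists h, Z1 (exist _ m h))) -> Y1 `<=` Z1.
    move=> E1 E2 [x xm] Yx.
    suff [h' Zx] : exists h', Z1 (exist _ x h') by rewrite (Prop_irrelevance xm h').
    have [xm'|nxm] := EM (x = m); first by subst x; apply: E2; exists xm.
    have Sx : S x.
      by apply: contrapT => /mmin mx; apply: nxm; apply: (wo_anti wo).
    have : [set s : I | exists h, Y1 (exist _ (sval s) h)] (exist _ x Sx) by exists xm.
    by rewrite E1.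
  split; apply: H => //.
  - by move=> ex; move: e2; do 2!case: pselect.
  - by move=> ex; move: e2; do 2!case: pselect.
have I0 : inhabited I.
  apply: contrapT => nI0; apply: nI.
  exists (fun _ _ => true) => Y Z _; apply/funext => s.
  by case: nI0; constructor.
exists I, le; split.
- apply: antisymmetric_well_order.
    by move=> [x Sx] [y Sy] /andP[h1 h2]; apply: val_inj; apply: (wo_anti wo).
  move=> P [s Ps].
  have [|m [Sm Pm] mmin] := wo_min wo (P := fun x => exists Sx : S x, (exist _ x Sx : I) \in P).
    by case: s Ps => x Sx; exists x, Sx.
  exists (exist _ m Sm); split=> // -[x Sx] Px.
  by apply: mmin; exists Sx.
- by split=> //; exists sval => -[x ?] [y ?] /= e; apply: val_inj.
(* A last point [s] would make [I] the segment up to [s], whose power set injects into [reals]. *)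
- move=> s; apply: contrapT => /forallNP smax; apply: nI.
  apply: injects_trans (goodI s).
  have les (x : I) : leK (sval x) (sval s).
    have [//|sx] := le_or_slt wo (sval x) (sval s).
    case: (smax x); move/andP: sx => [h1 h2]; apply/andP; split=> //.
  exists (fun Y => [set x | exists2 y, sval y = sval x & Y y]) => Y Z /seteqP[YZ ZY].
  apply/seteqP; split=> x xY.
    have [|y /val_inj <-//] := YZ (exist _ (sval x) (les x)) _; first by exists x.
  have [|y /val_inj <-//] := ZY (exist _ (sval x) (les x)) _; by exists x.
- exact: nI.
- have H (s : I) : exists g : reals -> set {x | leK x (sval s)}, forall t, exists u, g u = t.
    by have [g gP] := injects_surj (goodI s) set0; exists g.
  pose g s := projT1 (cid (H s)); have gP s t : exists u, g s u = t := projT2 (cid (H s)) t.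
  exists (fun (s : I) k (s' : I) => exists h, g s k (exist _ (sval s') h)) => s eta.
  have [k kE] := gP s [set x | exists2 s', sval s' = sval x & eta s'].
  exists k => s' s's; rewrite kE; split=> [[h [s'' /val_inj <-]]//|es'].
  by exists s's, s'.
Qed.

(** * Countability of the set of formulas *)

Section FormulaCount.
Variable L : language.

Fixpoint close_all n : formula L n -> sentence L :=
  match n return formula L n -> sentence L with
  | 0 => id
  | n.+1 => fun f => close_all (All f)
  end.

Lemma close_all_inj n : injective (@close_all n).
Proof.
pose body n (f : formula L n) : option (formula L n.+1) :=
  if f is All _ g then Some g else None.
by elim: n => //= n IH f g /IH /(congr1 (@body n)) [].
Qed.

(** By completeness each sentence or its negation lies in [T], so sentences are counted by [T] and a
    tag. Universal closure, injective as a syntactic operation, reduces formulas to sentences. *)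
Lemma countable_formulas (T : set (sentence L)) : complete_theory T -> countable T ->
  injects {m & formula L m} nat.
Proof.
move=> [_ T_or] /card_le_setTr [f fi].
have [nn nni] : injects (nat * nat) nat.
  by exists pickle; apply: pcan_inj pickleK.
pose g (s : sentence L) : nat * nat := match pselect (T s) with
  | left h => (0, f (exist _ s h))
  | right h => if pselect (T (Neg s)) is left h' then (1, f (exist _ (Neg s) h')) else (0, 0)
  end.
have gP s : (exists h, g s = (0, f (exist _ s h))) \/
    (exists h, g s = (1, f (exist _ (Neg s) h))).
  rewrite /g; case: pselect => [h|nh]; first by left; exists h.
  case: pselect => [h|nh']; first by right; exists h.
  by case: (T_or s) => h; [case: nh|case: nh'].
pose lhs n (f : formula L n) : option (formula L n) :=
  if f is Imp _ g _ then Some g else None.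
have gi : injective g.
  move=> s s'; have [[h ->]|[h ->]] := gP s; have [[h' ->]|[h' ->]] := gP s' => //.
    by case=> /fi/(congr1 sval).
  by case=> /fi/(congr1 (fun p => @lhs 0 (sval p))) [].
exists (fun p => nn (tag p, nn (g (close_all (tagged p))))).
by move=> [m p] [n q] /nni[/= mn /nni/gi]; subst n => /close_all_inj ->.
Qed.

Lemma countable_formulas_succ : injects {m & formula L m} nat ->
  injects {m & formula L m.+1} nat.
Proof.
move=> h; apply: (injects_trans _ h).
exists (fun p : {m & formula L m.+1} => existT (formula L) (projT1 p).+1 (projT2 p)).
move=> [m f] [n g] /= e; have [mn] := congr1 tag e; subst n.
by rewrite (@existT_inj nat _ _ _ _ e).
Qed.

Lemma countable_formulas_sum : injects {m & formula L m} nat ->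
  injects {p : nat * nat & formula L (p.1 + p.2).+1} nat.
Proof.
move=> h; have [nn nni] : injects (nat * nat * nat) nat.
  by exists pickle; apply: pcan_inj pickleK.
have [f fi] := h; exists (fun p => nn (projT1 p, f (existT (formula L) _ (projT2 p)))).
move=> [m p] [n q] /nni[/= mn /fi e]; subst n.
by rewrite (@existT_inj nat _ _ _ _ e).
Qed.

End FormulaCount.

(** * Cardinal bounds for the tree *)

Lemma small_reals kappa : inaccessible kappa -> card_lt [set: reals] [set: kappa].
Proof.
move=> [[/card_le_setT[f fi] nk] strong _].
have /strong : card_lt (range f) [set: kappa].
  by apply: card_lt_trans (card_image_le _ _) _; split=> //; apply/card_le_setT; exists f.
apply: card_lt_trans.
apply: (@card_le_fun _ _ _ _ (fun b : reals => [set f n | n in [set n | b n]])).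
  by move=> b _ _ [n _ <-]; exists n.
move=> b c _ _ bc; apply/funext => n.
have H (b1 : reals) : b1 n <-> [set f n | n in [set n | b1 n]] (f n).
  by split=> [bn|[m bm /fi <-]//]; exists n.
by apply/idP/idP => /H; [rewrite bc|rewrite -bc] => /H.
Qed.

(** Bounds the [|A'|^|T|] of the definition of stability, by [(2^aleph_0)^aleph_0 = 2^aleph_0]. *)
Lemma small_functions T C (D : set T) (A : set C) : countable D -> A #<= [set: reals] ->
  injects [set f : D -> C | range f `<=` A] reals.
Proof.
move=> /card_le_setTr cD /card_le_setTr cA.
have cD' : injects D nat.
  apply: injects_trans cD.
  exists (fun x : D => exist _ (val x) (set_mem (valP x))) => x y e.
  by apply: val_inj; apply: (congr1 sval e).
apply: (injects_trans _ (injects_fun_reals cD')).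
apply: (injects_trans _ (injects_fun D cA)).
exists (fun (f : [set f : D -> C | range f `<=` A]) x =>
  exist _ (val f x) (set_mem (valP f) _ (imageP (val f) (I : setT x)))) => f g /funeqP fg.
by apply: val_inj; apply/funext => x; apply: (congr1 sval (fg x)).
Qed.

(** * Density of isolated types, unions of chains *)

Section Existence.
Variables (L : language) (T : set (sentence L)) (C : structure L) (kappa : Type).
Hypothesis satC : saturated C kappa.
Hypothesis inaccK : inaccessible kappa.
Hypothesis Tcount : countable T.
Hypothesis Lcount : injects {m & formula L m} nat.

(** If density failed below [D0], the tree would yield as many types as [I] has subsets, against the
    bound given by stability. *)
Lemma stable_dense (A : set C) : A !=set0 -> complete_set A -> stable T kappa A ->
  dense_isolated A.
Proof.
move=> [a0 Aa0] cA stA D0 m0 phi D0def D0ne; apply: contrapT => none.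
have [I [le [wo [II [s0]] nomax nI [dec decP]]]] := branching_order.
have [leK woK] := well_ordering_principle {classic reals}.
pose K := {classic reals}.
have NR := injects_nat_reals.
have RR := infinite_square NR.
have SR := infinite_sum NR.
have cX : injects (name I K) reals.
  apply: (injects_trans _ RR); apply: injects_prod NR.
  apply: (injects_trans _ RR); apply: injects_prod; last by exists id.
  by apply: (injects_trans _ RR); apply: injects_prod II _; exists id.
have cNX : injects (nat -> name I K) reals.
  apply: injects_trans (injects_fun nat cX) _; apply: injects_fun_reals.
  by exists id.
have cT : injects (task L I K) reals.
  apply: (@injects_trans _ (option reals)).
    apply: injects_option; apply: (injects_trans _ SR); apply: injects_sum.
    - apply: (injects_trans _ RR); apply: injects_prod cNX.
      by apply: (injects_trans _ NR); apply: countable_formulas_sum.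
    - apply: (injects_trans _ RR); apply: injects_prod cNX.
      by apply: (injects_trans _ NR); apply: countable_formulas_succ.
  apply: (injects_trans _ SR).
  exists (fun o => if o is Some x then inl x else inr (fun=> true)).
  by move=> [x|] [y|] // [->].
(* There are at most continuum many tasks, so the codes in [K] can list them all; [k0] is a code of
   [None]. *)
have [e eP] := injects_surj cT None.
have [k0 ek0] := eP None.
have sX : small kappa [set: name I K].
  by apply: card_lt_trans (small_reals inaccK); apply/card_le_setT.
have [|A1 [A1X A1A [p [pi pS]]]] := tree_types satC cA Aa0 D0def D0ne _ wo nomax s0
    woK decP eP ek0 sX (phi := phi).
  by move=> E Edef Ene ED dE; apply: none; exists E.
have A1s : small kappa A1 by apply: card_lt_trans sX.
apply: nI.
have /card_le_set_type h1 := stA A1 A1s A1A.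
apply: injects_trans (injects_trans h1 _).
  exists (fun eta => SigSub (mem_set (pS eta))) => eta eta' /(congr1 val) /=.
  exact: pi.
apply: small_functions => //.
by apply: card_le_trans A1X _; apply/card_le_setT.
Qed.

(** One isolating formula is taken for each of the countably many formulas; together they imply
    every member of the type, each being an instance of one of these. *)
Lemma locally_isolated_aleph1 n (c : 'I_n -> C) (B : set C) :
  locally_isolated (tp c B) -> aleph1_isolated (tp c B).
Proof.
move=> li.
have H (x : {m & formula L (n + m)}) : exists theta, tp c B theta /\
    Defs.implies [set theta] (Defs.restrict (tp c B) (projT2 x)).
  by have [theta] := li _ (projT2 x); exists theta.
have [th thP] := choice H.
exists (range th); split.
- by move=> _ [x _ <-]; have [] := thP x.
- apply: card_le_trans (card_image_le _ _) _; apply/card_le_setT.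
  apply: (injects_trans _ Lcount).
  exists (fun x => existT (formula L) (n + projT1 x)%N (projT2 x)).
  move=> [m f] [k g] /= e; have [/addnI mk] := congr1 tag e; subst k.
  by rewrite (@existT_inj nat _ _ _ _ e).
- move=> v vr [k f a] pf; pose x := existT (fun m => formula L (n + m)) k f.
  have [_ /(_ v)] := thP x; apply=> [_ ->|]; first by apply: vr; exists x.
  by split=> //; exists a; left.
Qed.

Lemma chain_tuple (F : set (set C)) m (b : 'I_m -> C) : F !=set0 -> total_on F subset ->
  tuple_in (\bigcup_(X in F) X) b -> exists2 X, F X & tuple_in X b.
Proof.
move=> [X0 FX0] Ftot; elim: m b => [|m IH] b bF.
  by exists X0 => // -[].
have [X FX bX] := IH (b \o lift ord0) (fun i => bF _).
have [Y FY bY] := bF ord0.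
have [Z FZ [XZ YZ]] : exists2 Z, F Z & X `<=` Z /\ Y `<=` Z.
  by have [XY|YX] := Ftot _ _ FX FY; [exists Y|exists X] => //; split.
exists Z => // i; case: (unliftP ord0 i) => [j ->|->]; last exact: YZ.
exact/XZ/bX.
Qed.

Lemma chain_complete (F : set (set C)) : F !=set0 -> total_on F subset ->
  F `<=` @complete_set L C -> complete_set (\bigcup_(X in F) X).
Proof.
move=> Fne Ftot Fc n m psi b /(chain_tuple Fne Ftot)[X FX bX] ex.
have [a [aX pa]] := Fc X FX n m psi b bX ex.
by exists a; split=> // i; have [? ?] := aX i; split=> //; exists X.
Qed.

Lemma chain_Ppart (F : set (set C)) N : F !=set0 -> (forall X, F X -> Ppart X = N) ->
  Ppart (\bigcup_(X in F) X) = N.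
Proof.
move=> [X0 FX0] FN; apply/seteqP; split=> [x [[X FX Xx] xP]|x].
  by rewrite -(FN X FX).
by rewrite -(FN _ FX0) => -[? ?]; split=> //; exists X0.
Qed.

Lemma elementary_Tarski_Vaught (M : set C) :
  (forall m (f : formula L m.+1) v, tuple_in M v ->
     (exists x, holds f (vcons x v)) -> exists2 x, M x & holds f (vcons x v)) ->
  elementary M.
Proof.
move=> TV n f; elim: f => {}n; do ?by move=> *; split.
  move=> f IHf g IHg v Mv.
  by have := IHf v Mv; have := IHg v Mv; rewrite /holds /= => -> ->.
move=> f IH v Mv.
have Mx x : M x -> tuple_in M (vcons x v).
  by move=> Mx i; case: (unliftP ord0 i) => [j ->|->]; rewrite ?vconsS ?vcons0.
split=> h x Mx'; last by apply/IH; [apply: Mx|apply: h].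
apply: contrapT => nf.
have [|y My /holds_neg nfy] := TV _ (Neg f) v Mv; first by exists x.
by apply: nfy; apply/IH; [apply: Mx|apply: h].
Qed.

End Existence.

(** * Construction of the model *)

Lemma nat_lexi_well_order (Z : eqType) (leZ : rel Z) : well_order leZ ->
  well_order (fun i j : nat * Z => (i.1 < j.1)%N || (i.1 == j.1) && leZ i.2 j.2).
Proof.
move=> wo; apply: antisymmetric_well_order.
  move=> [m x] [n y] /= /andP[/orP[mn|/andP[/eqP <- xy]] /orP[nm|/andP[/eqP e yx]]].
  - by have := ltn_trans mn nm; rewrite ltnn.
  - by rewrite e ltnn in mn.
  - by rewrite ltnn in nm.
  - by rewrite (wo_anti wo xy yx).
move=> P [[n0 x0] P0].
have exn : exists n, `[< exists x, (n, x) \in P >].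
  by exists n0; apply/asboolP; exists x0.
case: (ex_minnP exn) => n /asboolP exx nmin.
have [x Px xmin] := wo_min wo exx.
exists (n, x); split=> // -[m y] Py /=.
have nm : (n <= m)%N by apply: nmin; apply/asboolP; exists y.
move: nm; rewrite leq_eqVlt => /orP[/eqP e|->//]; subst m.
by rewrite eqxx ltnn /=; apply: xmin.
Qed.

Section Construction.
Variables (L : language) (C : structure L) (kappa : Type).
Hypothesis inaccK : inaccessible kappa.
Hypothesis Lcount : injects {m & formula L m} nat.
Variables (A N : set C) (a0 : C).
Hypotheses (As : small kappa A) (cA : complete_set A) (AN : Ppart A = N) (Aa0 : A a0).
Hypothesis points : forall B : set C, small kappa B -> complete_set B -> Ppart B = N ->
  forall D, def_over B D -> D !=set0 -> exists2 d, D d & isolated_over B d.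

(** A type of cardinality [|A| + aleph_0], which indexes the requirements. *)
Let Z := ({x | A x} + nat)%type.

Lemma nat_Z : injects nat Z.
Proof. by exists inr => m n []. Qed.

Lemma small_Z : card_lt [set: Z] [set: kappa].
Proof.
have [natA|Anat] := injects_total nat {x | A x}.
  apply: card_lt_trans As.
  have [f fi] : injects Z {x | A x}.
    apply: (injects_trans _ (infinite_sum natA)); apply: (injects_sum _ natA).
    by exists id.
  apply: (@card_le_fun _ _ _ _ (sval \o f)) => [z _|x y _ _ /= e].
    exact: svalP.
  by apply: fi; case: (f x) (f y) e => [? ?] [? ?] /= e; apply: eq_exist.
have [natk _ _] := inaccK; apply: card_lt_trans natk; apply/card_le_setT.
have nn : injects nat nat by exists id.
by apply: (injects_trans _ (infinite_sum nn)); apply: injects_sum.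
Qed.

(** Rounds numbered by [nat], each running through all requirements: the parameters of a requirement
    occur in finitely many rounds, so a later round can meet it. *)
Let I : eqType := (nat * {classic Z})%type.
Let point := ({x | A x} + I)%type.

Lemma point_Z : injects point Z.
Proof.
apply: (injects_trans _ (infinite_sum nat_Z)); apply: injects_sum.
  by exists inl => x y [].
apply: (injects_trans _ (infinite_square nat_Z)); apply: injects_prod nat_Z _.
by exists id.
Qed.

Variable e : Z -> {m & formula L m.+1} * seq point.
Hypothesis eP : forall tau, exists z, e z = tau.
Variable leZ : rel {classic Z}.
Hypothesis woZ : well_order leZ.

Definition leI (i j : I) := (i.1 < j.1)%N || (i.1 == j.1) && leZ i.2 j.2.

Lemma woI : well_order leI.
Proof. exact: nat_lexi_well_order. Qed.

Definition value (d : I -> C) (y : point) : C :=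
  match y with inl a => sval a | inr i => d i end.

Definition before (i : I) (y : point) :=
  match y with inl _ => True | inr j => slt leI j i end.

Definition stage (d : I -> C) (i : I) := A `|` d @` [set j | slt leI j i].

(** Lists avoid the dependence on [m] in the enumeration [e]; [a0] fills up a list that is too
    short. *)
Definition params m (s : seq point) (k : 'I_m) : point :=
  nth (inl (exist _ a0 Aa0)) s k.

(** The requirement handled at [i] binds only if its parameters come before [i] and it is
    satisfiable, so that it can always be respected. *)
Definition next_point (i : I) (d : I -> C) (c : C) := isolated_over (stage d i) c /\
  forall m (f : formula L m.+1) s, e i.2 = (existT _ m f, s) ->
    (forall k : 'I_m, before i (params s k)) ->
    (exists x, holds f (vcons x (value d \o params s))) ->
    holds f (vcons c (value d \o params s)).

Lemma next_local i d d' c : (forall j, slt leI j i -> d j = d' j) -> next_point i d c -> next_point i d' c.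
Proof.
move=> dd'.
have sE : stage d i = stage d' i.
  congr (_ `|` _); apply/seteqP; split=> _ [j ji <-]; exists j => //.
    by rewrite -dd'.
  exact: dd'.
move=> [iso gen]; split=> [|m f s es bs]; first by rewrite -sE.
have <- : value d \o params s = value d' \o @params m s.
  by apply/funext => k /=; have := bs k; case: (params s k) => //= j /dd'.
exact: gen.
Qed.

Lemma small_union (d : I -> C) (Q : set I) : A `|` d @` Q #<= [set: Z].
Proof.
apply: (@card_le_trans _ _ _ [set: point]); last by apply/card_le_setT/point_Z.
apply: (@card_le_surj _ _ _ (value d)) => c [Ac|[j Qj <-]].
  by exists (inl (exist _ c Ac)).
by exists (inr j).
Qed.

Lemma next_exists i d : complete_set (stage d i) -> Ppart (stage d i) = N ->
  exists c, next_point i d c.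
Proof.
move=> cS SN.
have sS : small kappa (stage d i) := card_lt_trans (small_union _ _) small_Z.
case ei : (e i.2) => [[m f] s].
(* Without a binding requirement any isolated point will do, and [D] is everything. *)
pose D := if pselect ((forall k : 'I_m, before i (params s k)) /\
                     exists x, holds f (vcons x (value d \o params s)))
          is left _ then [set x | holds f (vcons x (value d \o params s))] else setT.
have [||c Dc isoc] := points sS cS SN (D := D).
- rewrite /D; case: pselect => [[bs _]|_]; last exact: def_overT.
  exists m, f, (value d \o params s); split=> // k /=.
  have := bs k; case: (params s k) => [[a Aa] _|j ji] /=; first by left.
  by right; exists j.
- rewrite /D; case: pselect => [[_ [x xf]]|_]; first by exists x.
  by exists a0.
exists c; split=> // m' f' s'; rewrite ei => E bs ex.
have /= ? := congr1 (fun p => tag p.1) E; subst m'.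
have /= ? := congr1 snd E; subst s'.
have ? := @existT_inj nat _ _ _ _ (congr1 fst E); subst f'.
by move: Dc; rewrite /D; case: pselect => // -[]; split.
Qed.

Variable d : I -> C.
Hypothesis dP : forall i, (exists c, next_point i d c) -> next_point i d (d i).

Definition closed_stage (i : I) := stage d i `|` [set d i].

Lemma closed_stageE i : closed_stage i = A `|` d @` [set j | leI j i].
Proof.
apply/seteqP; split=> c.
- case=> [[Ac|[j /andP[ji _] <-]]|->]; first by left.
    by right; exists j.
  by right; exists i => //; apply: (wo_refl woI).
- case=> [Ac|[j ji <-]]; first by left; left.
  have [->|nij] := eqVneq j i; first by right.
  by left; right; exists j => //; apply/andP.
Qed.

(** [A] belongs to the chain, which is thus nonempty even at the first stage. *)
Definition stages (Q : set I) : set (set C) :=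
  [set X | X = A \/ exists2 j, Q j & X = closed_stage j].

Lemma stages_union (Q : set I) : (forall i j, Q i -> leI j i -> Q j) ->
  \bigcup_(X in stages Q) X = A `|` d @` Q.
Proof.
move=> Qdown; apply/seteqP; split=> c.
- move=> [X [->|[j Qj ->]]]; first by left.
  rewrite closed_stageE => -[Ac|[k kj <-]]; first by left.
  by right; exists k => //; apply: Qdown kj.
- case=> [Ac|[j Qj <-]]; first by exists A => //; left.
  by exists (closed_stage j); [right; exists j|right].
Qed.

Lemma stages_total Q : total_on (stages Q) subset.
Proof.
have sub j : A `<=` closed_stage j by rewrite closed_stageE; apply: subsetUl.
move=> _ _ [->|[i Qi ->]] [->|[j Qj ->]]; [by left|by left|by right|].
rewrite !closed_stageE; have [ij|ji] := wo_total woI i j; [left|right];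
  apply: setUS => _ [k /= kl <-]; exists k => //=; exact: (wo_trans woI kl).
Qed.

Lemma stages_ne Q : stages Q !=set0.
Proof. by exists A; left. Qed.

(** By induction, the stage is the union of a chain made of [A] and closed stages, each of these
    adding to a good stage a point isolated over it. *)
Lemma stage_good i : complete_set (stage d i) /\ Ppart (stage d i) = N.
Proof.
elim/(well_founded_ind (slt_wf woI)) : i => i IH.
have Qdown k j : slt leI k i -> leI j k -> slt leI j i.
  move=> ki jk; have [ij|//] := le_or_slt woI i j.
  by have := slt_le_trans woI ki (wo_trans woI ij jk); rewrite sltxx.
have good X : stages [set j | slt leI j i] X -> complete_set X /\ Ppart X = N.
  move=> [->|[j /IH[cj Nj] ->]]; first by [].
  have [iso _] := dP (next_exists cj Nj).
  by split; [apply: isolated_complete|rewrite -Nj; apply: isolated_Ppart].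
rewrite /stage -(stages_union Qdown); split.
- by apply: chain_complete (stages_ne _) (@stages_total _) _ => X /good[].
- by apply: chain_Ppart (stages_ne _) _ => X /good[].
Qed.

Lemma next_d i : next_point i d (d i).
Proof. by have [cS SN] := stage_good i; apply: dP; apply: next_exists. Qed.

Definition limit_set := A `|` range d.

Lemma limit_set_union : limit_set = \bigcup_(X in stages setT) X.
Proof. by rewrite stages_union. Qed.

Lemma limit_set_Ppart : Ppart limit_set = N.
Proof.
rewrite limit_set_union; apply: chain_Ppart (stages_ne _) _ => X [->//|[j _ ->]].
have [cS SN] := stage_good j; have [iso _] := next_d j.
by rewrite -SN; apply: isolated_Ppart.
Qed.

Lemma limit_set_small : small kappa limit_set.
Proof. exact: card_lt_trans (small_union _ _) small_Z. Qed.

Lemma limit_set_card : card_le_plus_aleph0 limit_set A.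
Proof.
apply: card_le_trans (small_union _ _) _.
apply: (@card_le_fun _ _ _ _ (fun z : Z => match z with inl a => inl (sval a) | inr n => inr n end)).
  by move=> [[a Aa]|n].
move=> [[a Aa]|n] [[b Bb]|m] _ _ //= [] => [ab|-> //].
by congr inl; apply: eq_exist.
Qed.

(** Tarski-Vaught test: the parameters appear before some round [n0], in which every requirement
    gets its turn. *)
Lemma limit_set_elementary : elementary limit_set.
Proof.
apply: elementary_Tarski_Vaught => m f v Mv ex.
have vy (k : 'I_m) : exists y : point, value d y = v k.
  by have [Ak|[j _ jk]] := Mv k; [exists (inl (exist _ _ Ak))|exists (inr j)].
have [y yv] := choice vy.
(* [lev] is the round plus one, and zero on [A], so [n0] exceeds the round of every parameter. *)
pose lev (p : point) : nat := if p is inr j then j.1.+1 else 0.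
pose n0 := \max_(k < m) lev (y k).
pose s := [seq y k | k <- enum 'I_m].
have [z ez] := eP (existT _ m f, s).
have sE : @params m s = y.
  apply/funext => k; rewrite /params (nth_map k) ?size_enum_ord//.
  by rewrite nth_ord_enum.
pose i : I := (n0, z).
have [_ /(_ m f s ez)] := next_d i.
have vE : value d \o y = v by apply/funext => k; apply: yv.
rewrite sE vE => gen; exists (d i); first by right; exists i.
apply: gen => // k; rewrite /before.
case yk : (y k) => [//|j].
have jn : (j.1 < n0)%N.
  by apply: leq_trans (leq_bigmax k); rewrite yk.
rewrite /slt /leI /= jn /=; apply/eqP => ji.
by rewrite ji ltnn in jn.
Qed.

Lemma limit_set_constructible : locally_constructible A limit_set /\ aleph1_constructible A limit_set.
Proof.
have H i : isolated_over (stage d i) (d i) by have [] := next_d i.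
split; exists I, leI, d; split=> [||i]; try by [exact: woI|].
  exact: (isolated_tp (H i)).
apply: locally_isolated_aleph1 => //; exact: (isolated_tp (H i)).
Qed.

End Construction.

Lemma constructible_model (L : language) (C : structure L) (kappa : Type) (A N : set C) :
  inaccessible kappa -> injects {m & formula L m} nat ->
  small kappa A -> complete_set A -> Ppart A = N -> A !=set0 ->
  (forall B : set C, small kappa B -> complete_set B -> Ppart B = N ->
    forall D, def_over B D -> D !=set0 -> exists2 d, D d & isolated_over B d) ->
  exists M : set C,
    [/\ model kappa M, A `<=` M, Ppart M = Ppart A & card_le_plus_aleph0 M A] /\
    locally_constructible A M /\ aleph1_constructible A M.
Proof.
move=> inaccK Lcount As cA AN [a0 Aa0] points.
pose Z := ({x | A x} + nat)%type.
have NZ : injects nat Z by exists inr => m n [].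
have ZZ := infinite_square NZ.
have [leZ woZ] := well_ordering_principle {classic Z}.
pose point := ({x | A x} + nat * {classic Z})%type.
have pZ : injects point Z by apply: point_Z.
have cT : injects ({m & formula L m.+1} * seq point) Z.
  apply: (injects_trans _ ZZ); apply: injects_prod.
    exact: injects_trans (countable_formulas_succ Lcount) NZ.
  apply: (injects_trans _ (infinite_seq NZ)); have [f fi] := pZ.
  by exists (map f); apply: inj_map.
(* A requirement is a formula with a list of points, and there are no more of these than elements of
   [Z]. *)
have [e eP] := injects_surj cT (existT _ 0 (Bot L 1), [::]).
have [i f g c|d dP] := wo_choice (woI woZ) a0 (R := next_point Aa0 e leZ).
  exact: next_local.
exists (@limit_set L C A d); split; last first.
  exact: (limit_set_constructible inaccK Lcount As cA AN points woZ dP).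
split.
- split; first exact: limit_set_small.
  exact: (limit_set_elementary inaccK As cA AN points eP woZ dP).
- by move=> x Ax; left.
- rewrite AN; exact: (limit_set_Ppart inaccK As cA AN points woZ dP).
- exact: limit_set_card.
Qed.

(** * Existence of locally constructible models over complete sets *)

Theorem theorem7p6 (L : language) (T : set (sentence L))
    (C : structure L) (kappa : Type) (N : set C)
    (T_complete : complete_theory T)
    (T_countable : countable T)
    (T_P_infinite : P_infinite T)
    (T_qe : quantifier_elimination T)
    (C_monster : monster_model C T kappa)
    (C_stably_embedded : P_stably_embedded C)
    (C_no_new_structure : P_no_new_structure C)
    (N_small : small kappa N)
    (N_TP : models_TP N)
    (T_fully_stable : fully_stable T kappa N) :
  (full_existence_property kappa N /\
   forall A : set C, small kappa A -> complete_set A -> Ppart A = N ->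
     exists M : set C,
       [/\ model kappa M, A `<=` M, Ppart M = Ppart A &
           card_le_plus_aleph0 M A]) /\
  (forall A : set C, small kappa A -> complete_set A -> Ppart A = N ->
     exists M : set C,
       [/\ model kappa M, A `<=` M, Ppart M = Ppart A &
           card_le_plus_aleph0 M A] /\
       locally_constructible A M /\ aleph1_constructible A M).
Proof.
have [CT inaccK satC _] := C_monster.
have Lcount := countable_formulas T_complete T_countable.
(* Completeness for [x = x] with [x] bounded to [P], which is infinite, puts a point into [A]. *)
have ne (A : set C) : complete_set A -> A !=set0.
  move=> cA; have [p Pp] := infinite_setN0 (T_P_infinite C CT).
  have [||a [aA _]] := cA 1 0 (Eq L ord0 ord0) (@vempty C); first by case.
    by exists (fun=> p); split.
  by exists (a ord0); have [] := aA ord0.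
(* Full stability over [N] applies to every complete [B] whose part in [P] is [N], hence at each
   stage of the construction. *)
have points (B : set C) : small kappa B -> complete_set B -> Ppart B = N ->
    forall D, def_over B D -> D !=set0 -> exists2 d, D d & isolated_over B d.
  move=> Bs cB BN; apply: (dense_isolated_point satC Bs); first exact/card_le_setT/countable_formulas_succ.
  apply: (stable_dense satC inaccK T_countable Lcount (ne B cB) cB).
  exact: T_fully_stable.
have main A (As : small kappa A) (cA : complete_set A) (AN : Ppart A = N) :=
  constructible_model inaccK Lcount As cA AN (ne A cA) points.
split; last exact: main.
split=> A As cA AN; have [M [[Mm AM MP Mc] _]] := main A As cA AN; exists M; split=> //.
Qed.
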